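(* Let $K$ be a $d$-dimensional Cohen–Macaulay simplicial complex with face poset $P$, and let $\Delta=\Delta(P)$. Let $S,T\subseteq[d]=\{1,\dots,d\}$, and suppose that $S$ dominates $T$. Then the flag h-vector of $\Delta$ satisfies $h_T\le h_S$.
   Context: The face poset of $K$ is the set of faces of $K$ ordered by inclusion, the rank of a face being its number of vertices; $\Delta(P)$ is the order complex (simplices are chains of $P$). For a set $S$ of positive ranks, $f_S$ is the number of maximal chains of the rank-selected subposet $P_S=\{x\in P:\operatorname{rank}(x)\in S\}$ (so $f_\emptyset=1$), and the flag h-vector is $h_S=\sum_{T\subseteq S}(-1)^{|S\setminus T|}f_T$. $K$ is Cohen–Macaulay if for every face $F$ of $K$ one has $\tilde H_i(\operatorname{lk}(F))=0$ for all $i<\dim\operatorname{lk}(F)$, where $\operatorname{lk}(F)=\{G\in K:F\cap G=\emptyset,\ F\cup G\in K\}$ (reduced homology with coefficients in a fixed field). Dominance: for $\sigma=\sigma_1\cdots\sigma_m\in S_m$ (written as a word) the descent set is $d(\sigma)=\{i:\sigma_i>\sigma_{i+1}\}$. Interchanging $\sigma_i$ and $\sigma_{i+1}$ for some $i\in[m-1]$ with $i\notin d(\sigma)$ is called a switch; $\sigma<_w\tau$ (weak order) if $\tau$ can be obtained from $\sigma$ by a sequence of switches. Let $D_S=\{\sigma\in S_m:d(\sigma)=S\}$. $S$ dominates $T$ if there is an injection $\phi:D_T\to D_S$ with $\tau<_w\phi(\tau)$ for all $\tau\in D_T$. Here, for $S,T\subseteq[d]$, dominance is taken with $m=d+1$.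 *)

(* Defs.v *)
From HB Require Import structures.
From mathcomp Require Import all_boot all_order all_algebra all_fingroup.

Set Implicit Arguments.
Unset Strict Implicit.
Unset Printing Implicit Defensive.

Import Order.TTheory GRing.Theory Num.Theory.
Local Open Scope ring_scope.

Section Complexes.
Variable V : finType.
Implicit Types (K L : {set {set V}}) (F G : {set V}).

(* V may have elements that are not vertices of K; the empty face always
   belongs to K. *)
Definition simplicial_complex K : Prop :=
  set0 \in K /\ (forall F G, F \in K -> G \subset F -> G \in K).

Definition face_dim G : int := #|G|%:Z - 1.

Definition complex_dim K : int := (\max_(G in K) #|G|)%:Z - 1.

Definition link K F : {set {set V}} :=
  [set G in K | [disjoint F & G] & F :|: G \in K].

End Complexes.

Section Homology.
Variables (k : fieldType) (V : finType).
Implicit Types (L : {set {set V}}) (F G : {set V}) (i : int).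

(* Chains of the full simplex on V, all degrees together; chains of a
   subcomplex are singled out below as subspaces. The empty set spans degree
   -1, so that the homology is reduced. *)
Definition chain := {ffun {set V} -> k^o}.

Definition face_chain F : chain := [ffun G => (G == F)%:R].

(* Vertices are oriented by their order in the enumeration of V. *)
Definition vertex_pos F (v : V) : nat :=
  #|[set u in F | (enum_rank u < enum_rank v)%N]|.

Definition boundary (c : chain) : chain :=
  \sum_(F : {set V}) c F *:
    \sum_(v in F) (-1) ^+ vertex_pos F v *: face_chain (F :\ v).

Lemma boundary_is_linear : linear boundary.
Proof.
move=> a c c'; rewrite /boundary scaler_sumr -big_split; apply: eq_bigr => F _.
by rewrite !ffunE scalerDl scalerA.
Qed.

HB.instance Definition _ :=
  GRing.isLinear.Build k chain chain _ boundary boundary_is_linear.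

Definition chains L i : {vspace chain} :=
  <<[seq face_chain G | G <- enum [set G in L | face_dim G == i]]>>%VS.

Definition cycles L i : {vspace chain} :=
  (chains L i :&: lker (linfun boundary))%VS.

Definition boundaries L i : {vspace chain} :=
  (linfun boundary @: chains L (i + 1))%VS.

(* The quotient of cycles by boundaries, realized as a linear complement of
   the boundaries in the cycles. *)
Definition reduced_homology L i : {vspace chain} :=
  (cycles L i :\: boundaries L i)%VS.

Definition cohen_macaulay (K : {set {set V}}) : Prop :=
  forall F, F \in K -> forall i : int, i < complex_dim (link K F) ->
    reduced_homology (link K F) i = 0%VS.

End Homology.

Section FlagVectors.
Variable V : finType.
(* A poset of faces is given by its set of elements; the order is inclusion
   and the rank is the cardinality. *)
Implicit Types (P C : {set {set V}}).

Definition order_complex P : {set {set {set V}}} :=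
  [set C : {set {set V}} | (C \subset P) &&
    [forall F in C, forall G in C, (F \subset G) || (G \subset F)]].

Definition maximal_chains P : {set {set {set V}}} :=
  [set C | maxset [in order_complex P] C].

Definition rank_selected n P (S : {set 'I_n}) : {set {set V}} :=
  [set F in P | [exists i in S, #|F| == i]].

Definition flag_f n P (S : {set 'I_n}) : nat :=
  #|maximal_chains (rank_selected P S)|.

Definition flag_h n P (S : {set 'I_n}) : int :=
  \sum_(T : {set 'I_n} | T \subset S) (-1) ^+ #|S :\: T| * (flag_f P T)%:Z.

End FlagVectors.

(* [d] = {1, ..., d}, inside {0, ..., d}. *)
Definition bracket (d : nat) : {set 'I_d.+1} := [set i : 'I_d.+1 | (0 < i)%N].

Section Dominance.
Variable m : nat.
Implicit Types (s t : 'S_m) (S T : {set 'I_m}).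

(* The word of s is s 0, s 1, ..., s (m - 1), so its letters in places i and
   i + 1, counted from 1, are s (i - 1) and s i. Descents are counted from 1. *)
Definition descents s : {set 'I_m} :=
  [set i : 'I_m | [exists j : 'I_m, (j.+1 == i :> nat) && (s i < s j)%N]].

Definition switch : rel 'S_m := fun s t =>
  [exists j : 'I_m, exists i : 'I_m,
    [&& j.+1 == i :> nat, i \notin descents s & t == (tperm j i * s)%g]].

Definition weak_le : rel 'S_m := connect switch.

Definition with_descents S : {set 'S_m} := [set s | descents s == S].

Definition dominates S T : Prop :=
  exists phi : 'S_m -> 'S_m,
    {in with_descents T &, injective phi} /\
    (forall t, t \in with_descents T ->
       phi t \in with_descents S /\ weak_le t (phi t)).

End Dominance.

(* Main.v *)
From HB Require Import structures.
Require Import Defs.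
From mathcomp Require Import all_boot all_order all_algebra all_fingroup.
From mathcomp Require Import zify ring.

Set Implicit Arguments.
Unset Strict Implicit.
Unset Printing Implicit Defensive.

Import Order.TTheory GRing.Theory Num.Theory.
Local Open Scope ring_scope.

(** Let [n = d.+1] and let [h_0, ..., h_n] be the h-vector of [K]. The proof
rests on the identity

  [h_S = sum_(0 <= i <= n) h_(n - i) * #|{s in D_S : the last letter of s is < i}|]

([flag_h_perms], with letters numbered from 0). A switch never increases
the last letter of a word ([weak_le_last]), so the injection that witnesses
the dominance of [S] over [T] shows that each of these counts is at least as
large for [S] as for [T]. It remains to see that the h-vector of a
Cohen-Macaulay complex is nonnegative, and to prove the identity.

Nonnegativity ([h_rev_ge0]). Let [D j] be the direct sum of the polynomial
rings [k[F]] over the faces [F] of size [j]. The restrictions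
[k[F] -> k[F :\ v]], with simplicial signs, make a complex
[D n -> ... -> D 1 -> D 0]. The part of it that belongs to a monomial with support
[G] is the chain complex of the link of [G], up to a shift; since [K] is pure
([cm_pure]), the Cohen-Macaulay condition makes the complex exact except at
[D n] ([diff_surj]). Choose distinct scalars [t v], after an extension of the
field if necessary, and let [theta c] be multiplication by the linear form
[sum_v t v ^+ c * x_v]. As Vandermonde matrices are invertible,
[theta 0, ..., theta j.-1] is a regular sequence on [D j]. The depth lemma
([regular_kernel]), applied along the complex, makes
[theta 0, ..., theta n.-1] regular on the kernel [Z n] of [D n -> D n.-1]. The
Hilbert function of [Z n] is an alternating sum of those of the [D j], hence the
quotient of [Z n] by the linear forms has dimension [h_(n - i)] in degree [i].

The identity. By purity [f_T] counts the chains of [K] with one face of each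
rank in [T] ([maximal_flags]). If [m] is the largest element of [T], or 0, this is
the number [f_m] of faces of size [m] times the number of chains below a face of
size [m]. The chains of subsets of the set of letters correspond to the
permutations with descent set contained in [T] ([perm_flag]), and the last letter
of the permutation is the largest one outside the union of the chain
([cover_last]). Writing [f_m = sum_i h_(n - i) * 'C(i, n - m)] gives
the version of the identity for [f_T] ([flag_f_perms]), and Moebius inversion
over the subsets of [S] gives the one for [h_S]. *)

(** * Functions with prescribed support *)

Section Supported.
Variables (k : fieldType) (I : finType).
Implicit Types (A B : {set I}) (f : {ffun I -> k^o}).

Definition delta (x : I) : {ffun I -> k^o} := [ffun y => (y == x)%:R].

Definition supported A : {vspace {ffun I -> k^o}} :=
  <<[seq delta x | x <- enum A]>>%VS.

Lemma ffun_delta f : f = \sum_x f x *: delta x.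
Proof.
apply/ffunP=> y; rewrite sum_ffunE (bigD1 y) //= big1 ?addr0; last first.
  by move=> x nxy; rewrite !ffunE eq_sym (negPf nxy) scaler0.
by rewrite !ffunE eqxx /GRing.scale /= mulr1.
Qed.

Lemma supportedP f A :
  reflect (forall x, x \notin A -> f x = 0) (f \in supported A).
Proof.
apply: (iffP idP) => [fA x nAx | fA].
  rewrite (@coord_span _ _ _ (in_tuple [seq delta x | x <- enum A]) f fA) sum_ffunE.
  apply: big1 => i _; rewrite ffunE.
  have : (in_tuple [seq delta x | x <- enum A])`_i \in [seq delta x | x <- enum A].
    by apply: mem_nth.
  case/mapP=> y; rewrite mem_enum => Ay ->; rewrite ffunE.
  by case: eqP => [exy|_]; [rewrite exy Ay in nAx | rewrite scaler0].
rewrite (ffun_delta f); apply: memv_suml => x _.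
have [Ax|/fA->] := boolP (x \in A); last by rewrite scale0r mem0v.
by apply: memvZ; apply: memv_span; apply: map_f; rewrite mem_enum.
Qed.

Lemma dim_supported A : \dim (supported A) = #|A|.
Proof.
have /eqP -> : \dim (supported A) == size [seq delta x | x <- enum A]; last first.
  by rewrite size_map -cardE.
set X := [seq _ | _ <- _].
suff : free (in_tuple X) by [].
apply/freeP => c c0 i.
have uX : uniq (enum A) by exact: enum_uniq.
have x0 : I by have := ltn_ord i; rewrite {2}size_map; case: (enum A) => // a.
have si : (i < size (enum A))%N by have := ltn_ord i; rewrite {2}size_map.
have nthX (j : 'I_(size X)) : (in_tuple X)`_j = delta (nth x0 (enum A) j).
  rewrite /= (nth_map x0) //; have := ltn_ord j; by rewrite {2}size_map.
move/ffunP/(_ (nth x0 (enum A) i)): c0.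
rewrite sum_ffunE (bigD1 i) //= big1 ?addr0; last first.
  move=> j nji; rewrite ffunE nthX ffunE nth_uniq //; last first.
    by have := ltn_ord j; rewrite {2}size_map.
  by rewrite eq_sym (inj_eq val_inj) (negPf nji) scaler0.
by rewrite ffunE nthX !ffunE eqxx /GRing.scale /= mulr1.
Qed.

End Supported.

(** * Regular sequences on graded modules *)

Section Regular.
Variables (k : fieldType) (X : vectType k) (th : nat -> 'End(X)).
Hypothesis thC : forall a b x, th a (th b x) = th b (th a x).
Implicit Types (M D Z : nat -> {vspace X}).

(** The degree [i] part of [(th 0, ..., th c.-1) M], for a graded module given by its
pieces [M i]; the operators [th b] raise the degree by one. *)
Definition theta_part c M i : {vspace X} :=
  if i is i'.+1 then (\sum_(b < c) th b @: M i')%VS else 0%VS.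

Definition stable M := forall b i, (th b @: M i <= M i.+1)%VS.

(** [th c] is a nonzerodivisor on [M / (th 0, ..., th c.-1) M] in degrees below
[N]. The bound is there because every module will live in one finite-dimensional
space, obtained by truncating polynomials in high degree. *)
Definition regular N c M := forall i, (i < N)%N -> forall x, x \in M i ->
  th c x \in theta_part c M i.+1 -> x \in theta_part c M i.

Definition quot_dim c M i : int :=
  (\dim (M i))%:Z - (\dim (theta_part c M i))%:Z.

Lemma stableP M b i x : stable M -> x \in M i -> th b x \in M i.+1.
Proof. by move=> sM Mx; apply: (subvP (sM b i)); apply: memv_img. Qed.

Lemma theta_part_sub c M i : stable M -> (theta_part c M i <= M i)%VS.
Proof. by case: i => [|i] sM /=; [exact: sub0v | apply/subv_sumP => b _]. Qed.

Lemma theta_partS c M i :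
  theta_part c.+1 M i.+1 = (theta_part c M i.+1 + th c @: M i)%VS.
Proof. by rewrite /= big_ord_recr. Qed.

Lemma theta_part_ind c M i x (P : X -> Prop) :
  P 0 -> (forall u v, P u -> P v -> P (u + v)) ->
  (forall b y i', (b < c)%N -> i = i'.+1 -> y \in M i' -> P (th b y)) ->
  x \in theta_part c M i -> P x.
Proof.
move=> P0 PD Pth; case: i Pth => [|i] Pth /=.
  by rewrite memv0 => /eqP->.
case/memv_sumP=> u uM ->; apply: big_ind => // b _.
by case/memv_imgP: (uM b isT) => y My ->; apply: (Pth b y i).
Qed.

Lemma theta_part_mem b c M i x : (b < c)%N -> x \in M i ->
  th b x \in theta_part c M i.+1.
Proof.
move=> ltbc Mx; suff sb : (th b @: M i <= theta_part c M i.+1)%VS.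
  by apply: (subvP sb); apply: memv_img.
exact: (sumv_sup (Ordinal ltbc)).
Qed.

Lemma theta_part_th c M i x : stable M ->
  x \in theta_part c M i -> forall b, th b x \in theta_part c M i.+1.
Proof.
move=> sM Jx b; move: Jx; apply: (theta_part_ind (P := fun x => th b x \in _)) => [|u v ? ?|a y i' ltac -> My].
- by rewrite linear0 mem0v.
- by rewrite linearD memvD.
by rewrite thC; apply: theta_part_mem => //; apply: stableP.
Qed.

(** The preimage of [theta_part c M i.+1] under [th c]; [th c] is regular
exactly when this is no more than [theta_part c M i]. *)
Definition colon c M i : {vspace X} :=
  (M i :&: (th c @^-1: theta_part c M i.+1))%VS.

Lemma dim_theta_partS c M i :
  (\dim (theta_part c.+1 M i.+1) + \dim (colon c M i) =
   \dim (theta_part c M i.+1) + \dim (M i))%N.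
Proof.
set U := colon c M i; rewrite theta_partS.
set J := theta_part c M i.+1; set W := (th c @: M i)%VS.
have thU : (th c @: U)%VS = (J :&: W)%VS.
  apply/vspaceP => x; apply/memv_imgP/memv_capP.
    case=> y /memv_capP[My]; rewrite -memv_preim => Jy ->.
    by split=> //; apply: memv_img.
  case=> Jx /memv_imgP[y My Ex]; exists y => //.
  by rewrite memv_cap My -memv_preim -Ex.
have kU : (U :&: lker (th c))%VS = (M i :&: lker (th c))%VS.
  apply/vspaceP => x; rewrite !memv_cap -memv_preim -andbA.
  case: (x \in M i) => //=; rewrite memv_ker; case: eqP => [->|]; first by rewrite mem0v.
  by rewrite andbF.
have := limg_ker_dim (th c) (M i); have := limg_ker_dim (th c) U.
rewrite thU kU -/W; have := dimv_sum_cap J W.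
by move: (\dim _) (\dim _) (\dim _) (\dim _) => *; lia.
Qed.

Lemma theta_part_colon c M i : stable M -> (theta_part c M i <= colon c M i)%VS.
Proof.
move=> sM; rewrite subv_cap theta_part_sub //=; apply/subvP => x Jx.
by rewrite -memv_preim; apply: theta_part_th.
Qed.

Lemma quot_dim0 c M : quot_dim c M 0 = (\dim (M 0))%:Z.
Proof. by rewrite /quot_dim /= dimv0 subr0. Qed.

Lemma quot_dim_ge0 c M i : stable M -> 0 <= quot_dim c M i.
Proof. by move=> sM; rewrite subr_ge0 lez_nat dimvS ?theta_part_sub. Qed.

Lemma quot_dimS c M i : quot_dim c.+1 M i.+1 = quot_dim c M i.+1 - quot_dim c M i
  + ((\dim (colon c M i))%:Z - (\dim (theta_part c M i))%:Z).
Proof. by have := dim_theta_partS c M i; rewrite /quot_dim; lia. Qed.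

(** Dividing by one more operator lowers the Hilbert function at most by its
shift, as the kernel of the multiplication can only slow the decrease. *)
Lemma quot_dimS_ge c M i : stable M ->
  quot_dim c M i.+1 - quot_dim c M i <= quot_dim c.+1 M i.+1.
Proof.
by move=> sM; rewrite quot_dimS lerDl subr_ge0 lez_nat dimvS ?theta_part_colon.
Qed.

Lemma quot_dimS_regular N c M i : stable M -> regular N c M -> (i < N)%N ->
  quot_dim c.+1 M i.+1 = quot_dim c M i.+1 - quot_dim c M i.
Proof.
move=> sM rM ltiN; rewrite quot_dimS.
suff -> : colon c M i = theta_part c M i by rewrite subrr addr0.
apply: subv_anti; rewrite theta_part_colon // andbT; apply/subvP => x.
by rewrite memv_cap -memv_preim => /andP[Mx Jx]; apply: rM.
Qed.

Lemma regularE N c M : stable M ->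
  (forall i, (i < N)%N ->
     quot_dim c.+1 M i.+1 = quot_dim c M i.+1 - quot_dim c M i) ->
  regular N c M.
Proof.
move=> sM qM i ltiN x Mx Jx.
have := qM i ltiN; rewrite quot_dimS => /eqP.
rewrite -subr_eq0 addrAC subrr add0r subr_eq0 eqz_nat => /eqP eqd.
have /eqP <- : colon c M i == theta_part c M i.
  by rewrite eq_sym eqEdim theta_part_colon // eqd leqnn.
by rewrite memv_cap Mx -memv_preim.
Qed.

(** The depth lemma: in an exact sequence [0 -> Z -> D -> Y -> 0] of graded
modules, if [th 0, ..., th j] is regular on [D] and [th 0, ..., th j.-1] on [Y],
then [th 0, ..., th j] is regular on [Z]. The point is that the sequence stays
exact on the left after division by [th 0, ..., th c.-1] for [c <= j]
([theta_part_cap]), so that a nonzerodivisor on the quotient of [D] is one on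
the quotient of [Z]. *)
Section Depth.
Variables (N j : nat) (bd : 'End(X)) (D Z Y : nat -> {vspace X}).
Hypothesis bdC : forall b x, bd (th b x) = th b (bd x).
Hypotheses (sD : stable D) (sZ : stable Z).
Hypothesis ZE : forall i x, (x \in Z i) = (x \in D i) && (bd x == 0).
Hypothesis bdD : forall i x, x \in D i -> bd x \in Y i.
Hypothesis bd_surj : forall i y, (i <= N)%N -> y \in Y i ->
  exists2 x, x \in D i & bd x = y.
Hypothesis rD : forall c, (c <= j)%N -> regular N c D.
Hypothesis rY : forall c, (c < j)%N -> regular N c Y.

Lemma theta_part_mono c i : (theta_part c Z i <= theta_part c D i)%VS.
Proof.
apply/subvP => x; apply: (theta_part_ind (P := fun x => x \in _)); [exact: mem0v | exact: memvD |].
by move=> b y i' ltbc -> ; rewrite ZE => /andP[Dy _]; apply: theta_part_mem.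
Qed.

Lemma theta_part_lift c i y : (i <= N)%N -> y \in theta_part c Y i ->
  exists2 x, x \in theta_part c D i & bd x = y.
Proof.
move=> leiN.
apply: (theta_part_ind (P := fun y => exists2 x, x \in _ & bd x = y)).
- by exists 0; rewrite ?mem0v ?linear0.
- move=> u v [x Dx <-] [x' Dx' <-]; exists (x + x'); rewrite ?linearD //.
  exact: memvD.
move=> b y' i' ltbc ei Yy'; have [|x Dx Ex] := bd_surj _ Yy'; first by lia.
by exists (th b x); rewrite ?bdC ?Ex // ei; apply: theta_part_mem.
Qed.

(** If [x] is [u + th c w] with [u] in the ideal of the earlier operators, then
[th c (bd w)] is in that ideal of [Y], hence so is [bd w] by regularity; a lift
[e] of [bd w] moves [w] into [Z] without leaving the ideal. *)
Lemma theta_part_cap c i x : (c <= j)%N -> (i <= N)%N ->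
  x \in Z i -> x \in theta_part c D i -> x \in theta_part c Z i.
Proof.
elim: c i x => [|c IHc] [|i] x lecj leiN Zx; rewrite ?theta_partS //.
  by rewrite /theta_part !big_ord0.
case/memv_addP=> u Du [v /memv_imgP[w Dw ->] Ex].
have bdJ : bd u \in theta_part c Y i.+1.
  move: Du; apply: (theta_part_ind (P := fun u => bd u \in _)) => [|u1 u2|b y i' ltbc [->] Dy].
  - by rewrite linear0 mem0v.
  - by rewrite linearD; apply: memvD.
  by rewrite bdC; apply: theta_part_mem => //; apply: bdD.
have : bd x == 0 by move: Zx; rewrite ZE => /andP[].

rewrite Ex linearD /= bdC addrC addr_eq0 => /eqP bdw.
have Jw : bd w \in theta_part c Y i.
  by apply: (rY lecj leiN) => //; [apply: bdD | rewrite bdw memvN].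
have [e De Ee] := theta_part_lift (ltnW leiN) Jw.
have Zw : w - e \in Z i.
  rewrite ZE linearB /= Ee subrr eqxx andbT memvB //.
  by apply: (subvP (theta_part_sub c i sD)).
have Ex' : x = (x - th c (w - e)) + th c (w - e) by rewrite subrK.
rewrite -/(theta_part c Z i.+1) -Ex Ex'; apply: memv_add; last exact: memv_img.
apply: IHc => //; [exact: ltnW | |].
  by apply: memvB => //; apply: stableP.
by rewrite Ex linearB /= opprB addrACA subrr addr0 memvD // theta_part_th.
Qed.

Lemma regular_kernel c : (c <= j)%N -> regular N c Z.
Proof.
move=> lecj i ltiN x Zx Jx; apply: theta_part_cap => //; first exact: ltnW.
apply: (rD lecj) => //; first by move: Zx; rewrite ZE => /andP[].
exact: (subvP (theta_part_mono c i.+1)).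
Qed.

End Depth.

End Regular.

(** * Regularity from a dimension count *)

Section Numeric.

(** The number of monomials of degree [i] in [j] variables. The truncated
predecessor gives the right values [1, 0, 0, ...] for [j = 0]. *)
Definition nmonom j i := 'C((j + i).-1, i).

Lemma nmonom0 j : nmonom j 0 = 1%N. Proof. by rewrite /nmonom bin0. Qed.
Lemma nmonom0S i : nmonom 0 i.+1 = 0%N. Proof. by rewrite /nmonom bin_small. Qed.
Lemma nmonomSS j i : nmonom j.+1 i.+1 = (nmonom j i.+1 + nmonom j.+1 i)%N.
Proof. by rewrite /nmonom !addSn addnS /= binS. Qed.

Variables (k : fieldType) (X : vectType k) (th : nat -> 'End(X)).
Hypothesis thC : forall a b x, th a (th b x) = th b (th a x).
Variables (N j f : nat) (D : nat -> {vspace X}).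
Hypothesis sD : stable th D.
Hypothesis dimD : forall i, (i <= N)%N -> \dim (D i) = (f * nmonom j i)%N.
Hypothesis fullD : forall i, (i < N)%N -> theta_part th j D i.+1 = D i.+1.

(** Knowing that all the operators together kill everything of positive degree
bounds the Hilbert function of each partial quotient from above; the lower bound
[quot_dimS_ge] starts from the known Hilbert function of [D]. Both bounds agree
([quot_dim_eq]), and equality means regularity ([regular_of_dim]). *)
Lemma quot_dim_le e c i : (e + c = j)%N -> (i <= N)%N ->
  quot_dim th c D i <= (f * nmonom e i)%:Z.
Proof.
elim: e c i => [|e IHe] c.
  case=> [|i] ej leiN.
    by rewrite quot_dim0 dimD // !nmonom0.
  rewrite nmonom0S muln0; move: ej; rewrite add0n => ->.
  by rewrite /quot_dim fullD // subrr.
elim=> [|i IHi] ej leiN; first by rewrite quot_dim0 dimD // !nmonom0.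
have := IHi ej (ltnW leiN); have := quot_dimS_ge thC c i sD.
have : (e + c.+1 = j)%N by lia.
by move/(IHe c.+1 i.+1)/(_ leiN); rewrite nmonomSS mulnDr; lia.
Qed.

Lemma quot_dim_eq c i : (c <= j)%N -> (i <= N)%N ->
  quot_dim th c D i = (f * nmonom (j - c) i)%:Z.
Proof.
elim: c i => [|c IHc] i lecj leiN.
  rewrite subn0 /quot_dim; case: i leiN => [|i] leiN /=.
    by rewrite dimv0 subr0 dimD.
  by rewrite big_ord0 dimv0 subr0 dimD.
case: i leiN => [|i] leiN; first by rewrite quot_dim0 dimD // !nmonom0.
apply/eqP; rewrite eq_le quot_dim_le ?subnK //=.
apply: le_trans (quot_dimS_ge thC c i sD).
rewrite !IHc //; try lia.
by rewrite -(subnSK lecj) nmonomSS mulnDr; lia.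
Qed.

Lemma regular_of_dim c : (c < j)%N -> regular th N c D.
Proof.
move=> ltcj; apply: regularE => // i ltiN; rewrite !quot_dim_eq //; try lia.
by rewrite -(subnSK ltcj) nmonomSS mulnDr; lia.
Qed.

End Numeric.

Section Nabla.
Implicit Types g : nat -> int.

(** Multiplication of the generating function of [g] by [1 - t]. *)
Definition nabla g i : int := if i is i'.+1 then g i'.+1 - g i' else g 0.

Lemma eq_nabla N c g g' : (forall i, (i <= N)%N -> g i = g' i) ->
  forall i, (i <= N)%N -> iter c nabla g i = iter c nabla g' i.
Proof.
elim: c => [|c IHc] gg' [|i] leiN //=; try exact: gg'; rewrite !IHc //.
exact: ltnW.
Qed.

Lemma iter_nabla_sum (I : Type) (r : seq I) (P : pred I) a (G : I -> nat -> int) c i :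
  iter c nabla (fun i => \sum_(j <- r | P j) a j * G j i) i =
  \sum_(j <- r | P j) a j * iter c nabla (G j) i.
Proof.
elim: c i => [|c IHc] [|i] //=; rewrite !IHc //.
by rewrite -sumrB; apply: eq_bigr => j _; rewrite mulrBr.
Qed.

Lemma iter_nabla_nmonom c j i : (c <= j)%N ->
  iter c nabla (fun i => (nmonom j i)%:Z) i = (nmonom (j - c) i)%:Z.
Proof.
elim: c i => [|c IHc] i lecj; first by rewrite subn0.
have lecj' := ltnW lecj.
case: i => [|i]; rewrite iterS /nabla !(IHc _ lecj') ?nmonom0 //.
have -> : (j - c = (j - c.+1).+1)%N by rewrite subnSK.
by rewrite nmonomSS PoszD addrK.
Qed.

Lemma iter_nabla_nmonom0 e i :
  iter e nabla (fun i => (nmonom 0 i)%:Z) i = (-1) ^+ i * ('C(e, i))%:Z.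
Proof.
elim: e i => [|e IHe] i.
  case: i => [|i]; rewrite /= ?nmonom0 ?bin0 ?mulr1 //.
  by rewrite nmonom0S bin0n mulr0.
case: i => [|i]; rewrite iterS /nabla !IHe ?bin0 //.
by rewrite binS PoszD exprS; ring.
Qed.

(** The generating function of [nmonom j] is [(1 - t) ^ (- j)]. *)
Lemma iter_nabla_nmonom_gt n j i : (j <= n)%N ->
  iter n nabla (fun i => (nmonom j i)%:Z) i = (-1) ^+ i * ('C(n - j, i))%:Z.
Proof.
move=> lejn; rewrite -[in iter n](subnK lejn) iterD -iter_nabla_nmonom0.
apply: (eq_nabla (N := i)) => // i' _.
by rewrite iter_nabla_nmonom // subnn.
Qed.

End Nabla.

(** * The simplicial boundary *)

Section Boundary.
Variables (k : fieldType) (V : finType).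
Implicit Types (F G H : {set V}) (c : chain k V) (K L : {set {set V}}).

Lemma chainsE L i : chains k L i = supported k [set G in L | face_dim G == i].
Proof. by []. Qed.

Lemma boundaryE c H :
  boundary c H = \sum_(v | v \notin H) (-1) ^+ vertex_pos (v |: H) v * c (v |: H).
Proof.
rewrite /boundary sum_ffunE.
under eq_bigr => F _.
  rewrite ffunE sum_ffunE /GRing.scale /= mulr_sumr.
  under eq_bigr => v _ do rewrite !ffunE /GRing.scale /=.
  over.
rewrite (exchange_big_dep predT) //= [RHS]big_mkcond /=.
apply: eq_bigr => v _; case: ifP => [nHv|/negbFE Hv].
  rewrite (bigD1 (v |: H)) ?setU11 //= big1 ?addr0; last first.
    move=> F /andP[Fv neF]; case: eqP => [eH|]; last by rewrite !mulr0.
    by rewrite eH setD1K ?eqxx // in neF.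
  by rewrite setU1K // eqxx mulr1 mulrC.
apply: big1 => F Fv; case: eqP => [eH|]; last by rewrite !mulr0.
by rewrite eH setD11 in Hv.
Qed.

(** Stated without dividing by two, so as to hold in characteristic two. *)
Lemma sum_antisym (A : {pred V}) (g : V -> V -> k) :
  (forall u v, g u v = - g v u) -> (forall u, g u u = 0) ->
  \sum_(u in A) \sum_(v in A) g u v = 0.
Proof.
move=> gN g0; pose lt (u v : V) := (enum_rank u < enum_rank v)%N.
have split u : \sum_(v in A) g u v =
    \sum_(v in A | lt u v) g u v - \sum_(v in A | lt v u) g v u.
  rewrite (bigID (lt u)) /= -sumrN; congr (_ + _).
  rewrite (bigID (lt^~ u)) /= [X in _ + X]big1 ?addr0.
    apply: eq_big => [v|v _]; last exact: gN.
    by rewrite /lt; case: (v \in A) => //=; case: ltngtP.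
  move=> v; rewrite /lt => /andP[/andP[_ +]].
  case: ltngtP => // /val_inj/enum_rank_inj-> _ _; exact: g0.
under eq_bigr => u _ do rewrite split.
rewrite sumrB [X in _ - X](exchange_big_dep (mem A)) /=; last by move=> ? ? ? /andP[].
rewrite -sumrB; apply: big1 => u Au; apply/eqP; rewrite subr_eq0; apply/eqP.
by apply: eq_bigl => v; rewrite Au.
Qed.

Lemma vertex_pos_setU1 F v u : v \notin F ->
  vertex_pos (v |: F) u = ((enum_rank v < enum_rank u) + vertex_pos F u)%N.
Proof.
move=> nFv; rewrite /vertex_pos.
rewrite (_ : [set w in v |: F | _] = [set w in [set v] | (enum_rank w < enum_rank u)%N]
   :|: [set w in F | (enum_rank w < enum_rank u)%N]); last first.
  by apply/setP=> w; rewrite !inE andb_orl.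
rewrite cardsU; rewrite (_ : _ :&: _ = set0) ?cards0 ?subn0; last first.
  apply/setP=> w; rewrite !inE; case: eqP => [->|//].
  by rewrite (negPf nFv) !andbF.
congr (_ + _)%N; case: ltnP => h.
  rewrite (_ : [set _ in _ | _] = [set v]) ?cards1 //.
  by apply/setP=> w; rewrite !inE; case: eqP => [->|].
rewrite (_ : [set _ in _ | _] = set0) ?cards0 //.
by apply/setP=> w; rewrite !inE; case: eqP => [->|//]; rewrite ltnNge h.
Qed.

Lemma vertex_pos_self F v : v \notin F -> vertex_pos (v |: F) v = vertex_pos F v.
Proof. by move=> nFv; rewrite vertex_pos_setU1 // ltnn. Qed.

Lemma vertex_posU F G u : [disjoint F & G] ->
  vertex_pos (F :|: G) u = (vertex_pos F u + vertex_pos G u)%N.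
Proof.
move=> dFG; rewrite /vertex_pos.
rewrite (_ : [set _ in F :|: G | _] =
  [set w in F | (enum_rank w < enum_rank u)%N] :|:
  [set w in G | (enum_rank w < enum_rank u)%N]); last first.
  by apply/setP=> w; rewrite !inE andb_orl.
rewrite cardsU (_ : _ :&: _ = set0) ?cards0 ?subn0 //.
apply/setP=> w; rewrite !inE andbACA.
by case: (boolP (w \in F)) => //= Fw; rewrite (disjointFr dFG).
Qed.

Lemma boundary_boundary c : boundary (boundary c) = 0.
Proof.
apply/ffunP=> H; rewrite boundaryE [RHS]ffunE.
pose g v u : k := if u == v then 0 else
  (-1) ^+ (vertex_pos H v + (enum_rank v < enum_rank u)%N + vertex_pos H u) *
  c (u |: (v |: H)).
rewrite -[RHS](@sum_antisym [pred v | v \notin H] g) => [|u v|u]; last first.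
- by rewrite /g eqxx.
- rewrite /g eq_sym; case: eqP => [_|nuv]; first by rewrite oppr0.
  rewrite setUCA -mulNr; congr (_ * _).
  rewrite -[RHS]mulN1r -exprS -signr_odd -[RHS]signr_odd; congr (_ ^+ _).
  have : enum_rank u != enum_rank v :> nat.
    by apply/eqP=> /val_inj/enum_rank_inj.
  by rewrite /= !oddD; do 2!case: (odd (vertex_pos _ _)); case: ltngtP.
apply: eq_bigr => v nHv.
rewrite boundaryE mulr_sumr [LHS]big_mkcond [RHS]big_mkcond.
apply: eq_bigr => u _; rewrite !inE negb_or.
rewrite /g; case: eqP => [_|/eqP nuv] /=; first by rewrite if_same.
case: ifP => // nHu; rewrite mulrA -exprD vertex_pos_self //.
by rewrite vertex_pos_self ?inE ?negb_or ?nuv // vertex_pos_setU1 // addnA.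
Qed.

(** The sign that compares the orientation of [H] as a face of the link of [G]
with that of [G :|: H]: it turns the boundary of the link into the part of the
boundary of the star that only removes vertices outside [G]. *)
Definition link_sign G H : k := (-1) ^+ (\sum_(w in H) vertex_pos G w).

Definition twist G c : chain k V :=
  [ffun H : {set V} => if [disjoint G & H] then link_sign G H * c (G :|: H) else 0].

Lemma boundary_twist G c : boundary (twist G c) = twist G (boundary c).
Proof.
apply/ffunP=> H; rewrite boundaryE ffunE; case: ifP => dGH; last first.
  apply: big1 => v _; rewrite ffunE; case: ifP; rewrite ?mulr0 // => dGvH.
  by rewrite (disjointWr (subsetUr _ _) dGvH) in dGH.
rewrite boundaryE mulr_sumr [LHS]big_mkcond [RHS]big_mkcond.
apply: eq_bigr => v _; rewrite ffunE disjoints_subset setCU subsetI.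
rewrite -!disjoints_subset dGH andbT disjoint_sym disjoints1 inE negb_or.
case: (boolP (v \in G)) => nGv /=; first by rewrite mulr0 if_same.
case: ifP => // nHv; rewrite setUCA 2!mulrA; congr (_ * _).
rewrite /link_sign big_setU1 //= -!exprD; congr (_ ^+ _).
rewrite vertex_pos_self // vertex_pos_self ?inE ?negb_or ?nGv ?nHv //.
by rewrite vertex_posU //; lia.
Qed.

Lemma link_sign2 G H : link_sign G H * link_sign G H = 1.
Proof. by rewrite /link_sign -exprD addnn -mul2n exprM sqrrN !expr1n. Qed.

Lemma homology0P L i : reduced_homology k L i = 0%VS <->
  (forall c, c \in chains k L i -> boundary c = 0 ->
     exists2 b, b \in chains k L (i + 1) & boundary b = c).
Proof.
rewrite /reduced_homology; split=> [/eqP|H].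
  rewrite diffv_eq0 => /subvP zb c Lc bc.
  have : c \in cycles k L i by rewrite memv_cap Lc memv_ker lfunE /= bc.
  by case/zb/memv_imgP=> b Lb ->; exists b; rewrite ?lfunE.
apply/eqP; rewrite diffv_eq0; apply/subvP => c /memv_capP[Lc].
rewrite memv_ker lfunE /= => /eqP/(H c Lc)[b Lb <-].
by apply/memv_imgP; exists b; rewrite ?lfunE.
Qed.

End Boundary.

(** * Vanishing of homology under field extension *)

Section BaseChange.
Variable V : finType.
Implicit Types (L : {set {set V}}) (F G H : {set V}).

(** The base change is made through matrices: a kernel and an inclusion of row
spaces commute with a field extension, and the boundary matrices over the two
fields are the image of one another since their entries are [0], [1] and [-1]. *)
Definition row_of (k : fieldType) (c : chain k V) : 'rV[k]_#|{set V}| :=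
  \row_j c (enum_val j).
Definition chain_of (k : fieldType) (u : 'rV[k]_#|{set V}|) : chain k V :=
  [ffun F => u 0 (enum_rank F)].
Definition boundary_mx (k : fieldType) : 'M[k]_#|{set V}| :=
  \matrix_(j < #|{set V}|, l < #|{set V}|)
    \sum_(v | v \notin (enum_val l : {set V}))
     (-1) ^+ vertex_pos (v |: enum_val l) v * (v |: enum_val l == enum_val j)%:R.
Definition coord_proj_mx (k : fieldType) (A : {set {set V}}) : 'M[k]_#|{set V}| :=
  \matrix_(j, l) ((j == l) && (enum_val j \in A))%:R.

Lemma row_ofK k : cancel (@row_of k) (@chain_of k).
Proof. by move=> c; apply/ffunP=> F; rewrite !ffunE mxE enum_rankK. Qed.

Lemma chain_ofK k : cancel (@chain_of k) (@row_of k).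
Proof. by move=> u; apply/rowP=> j; rewrite mxE ffunE enum_valK. Qed.

Lemma row_of_boundary (k : fieldType) (c : chain k V) :
  row_of (boundary c) = row_of c *m boundary_mx k.
Proof.
apply/rowP=> l; rewrite !mxE boundaryE.
under [RHS]eq_bigr do rewrite !mxE mulr_sumr.
rewrite exchange_big /=; apply: eq_bigr => v nv.
rewrite (bigD1 (enum_rank (v |: enum_val l))) //= enum_rankK eqxx mulr1 big1.
  by rewrite addr0 mulrC.
move=> j nj; case: eqP => [ej|_]; last by rewrite !mulr0.
by rewrite ej enum_valK eqxx in nj.
Qed.

Lemma supported_proj (k : fieldType) (A : {set {set V}}) (c : chain k V) :
  (c \in supported k A) = (row_of c *m (1%:M - coord_proj_mx k A) == 0).
Proof.
have E j : (row_of c *m (1%:M - coord_proj_mx k A)) 0 j =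
    c (enum_val j) * (enum_val j \notin A)%:R.
  rewrite !mxE (bigD1 j) //= !mxE eqxx big1 ?addr0.
    by rewrite /=; case: (_ \in A); rewrite ?subrr ?subr0.
  by move=> l nlj; rewrite !mxE (negPf nlj) subrr mulr0.
apply/supportedP/eqP => [cA|/rowP e0 F nF].
  apply/rowP=> j; rewrite E mxE; have [_|/cA->] := boolP (_ \in A).
    by rewrite mulr0.
  by rewrite mul0r.
by have := e0 (enum_rank F); rewrite E mxE enum_rankK nF mulr1.
Qed.

Lemma proj_supported (k : fieldType) (A : {set {set V}}) (u : 'rV[k]_#|{set V}|) :
  chain_of (u *m coord_proj_mx k A) \in supported k A.
Proof.
apply/supportedP => F nF; rewrite ffunE mxE big1 // => j _.
rewrite mxE; case: eqP => [->|_] /=; last by rewrite mulr0.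
by rewrite enum_rankK (negPf nF) mulr0.
Qed.

Definition faces_of_dim L (i : int) : {set {set V}} := [set G in L | face_dim G == i].

Lemma homology0_mx (k : fieldType) L i : reduced_homology k L i = 0%VS <->
  (kermx (row_mx (1%:M - coord_proj_mx k (faces_of_dim L i)) (boundary_mx k))
   <= coord_proj_mx k (faces_of_dim L (i + 1)%R) *m boundary_mx k)%MS.
Proof.
rewrite homology0P !chainsE -!/(faces_of_dim _ _); split=> [H|/row_subP kb c].
  apply/rV_subP => u /sub_kermxP; rewrite mul_mx_row => /eqP.
  rewrite row_mx_eq0 -[u]chain_ofK -supported_proj -row_of_boundary.
  case/andP=> Lc /eqP bc; case: (H _ Lc) => [|b].
    by rewrite -[boundary _]row_ofK bc; apply/ffunP => F; rewrite !ffunE mxE.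
  rewrite supported_proj mulmxBr mulmx1 subr_eq0 => /eqP Pb <-.
  by rewrite row_of_boundary Pb -mulmxA submxMl.
rewrite supported_proj => /eqP Lc bc.
have /rV_subP/(_ (row_of c)) := introT row_subP kb.
case/(_ _)/submxP => [|D].
  apply/sub_kermxP; rewrite mul_mx_row Lc -row_of_boundary bc.
  rewrite (_ : row_of 0 = 0) ?row_mx0 //; by apply/rowP=> j; rewrite !mxE ffunE.
rewrite mulmxA => Ec; exists (chain_of (D *m coord_proj_mx k (faces_of_dim L (i + 1)%R))).
  exact: proj_supported.
by rewrite -[LHS]row_ofK row_of_boundary chain_ofK -Ec row_ofK.
Qed.

Lemma homology0_map (k k' : fieldType) (f : {rmorphism k -> k'}) L i :
  reduced_homology k L i = 0%VS -> reduced_homology k' L i = 0%VS.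
Proof.
rewrite !homology0_mx.
have bdE : boundary_mx k' = map_mx f (boundary_mx k).
  apply/matrixP => j l; rewrite !mxE rmorph_sum; apply: eq_bigr => v _.
  by rewrite rmorphM rmorphXn rmorphN1 rmorph_nat.
have prE C : coord_proj_mx k' C = map_mx f (coord_proj_mx k C).
  by apply/matrixP => j l; rewrite !mxE rmorph_nat.
by rewrite bdE !prE -(map_mx1 f) -map_mxB -map_row_mx -map_kermx -map_mxM map_submx.
Qed.

Lemma cohen_macaulay_map (k k' : fieldType) (f : {rmorphism k -> k'}) K :
  @cohen_macaulay k V K -> @cohen_macaulay k' V K.
Proof. by move=> cmK F KF i li; apply: (homology0_map f); apply: cmK. Qed.

End BaseChange.

(** * Purity of Cohen-Macaulay complexes *)

Section Purity.
Variables (k : fieldType) (V : finType) (K : {set {set V}}) (n : nat).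
Hypotheses (cxK : simplicial_complex K) (dimK : complex_dim K = n%:Z - 1).
Hypothesis cmK : cohen_macaulay k K.
Implicit Types (F G H : {set V}).

Lemma card_face_le F : F \in K -> (#|F| <= n)%N.
Proof.
move=> KF; have : (\max_(G in K) #|G|)%N = n.
  by move: dimK; rewrite /complex_dim; lia.
by move=> <-; apply: (@leq_bigmax_cond _ (mem K) (fun G : {set V} => #|G|)).
Qed.

Lemma ex_max_face : exists2 G, G \in K & #|G| = n.
Proof.
have maxn : (\max_(G in K) #|G|)%N = n.
  by move: dimK; rewrite /complex_dim; lia.
case: (eq_bigmax_cond (fun G : {set V} => #|G|) (A := mem K)) => [|G KG eG].
  by apply/card_gt0P; exists set0; case: cxK.
by exists G; rewrite // -eG.
Qed.

Definition in_facet F := [exists G, [&& G \in K, F \subset G & #|G| == n]].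

(** Suppose that some faces lie in no face of size [n]; take such a face [E] and
a face [G] of size [n] with [I = E :&: G] as large as possible. Colour a vertex of
the link of [I] by whether together with [I] it lies in a face of size [n]. By
maximality no edge of the link joins two vertices of different colours, while both colours
occur, so that the link is disconnected. Yet its dimension is positive, and
its reduced homology in degree 0 should vanish. *)
Lemma cm_pure F : F \in K -> in_facet F.
Proof.
case: cxK => K0 Ksub KF; apply: contraT => badF.
have [G0 KG0 G0n] := ex_max_face.
pose P (p : {set V} * {set V}) :=
  [&& p.1 \in K, ~~ in_facet p.1, p.2 \in K & #|p.2| == n].
have P0 : P (F, G0) by rewrite /P /= KF badF KG0 G0n eqxx.
case: (@arg_maxnP _ (F, G0) P (fun p => #|p.1 :&: p.2|) P0) => [[E G]] /=.
case/and4P=> /= KE badE KG /eqP Gn; move eI: (E :&: G) => I maxI.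
have sIE : I \subset E by rewrite -eI subsetIl.
have sIG : I \subset G by rewrite -eI subsetIr.
have bad_max E' G' v : E' \in K -> v |: I \subset E' -> v \notin I ->
    v |: I \subset G' -> G' \in K -> #|G'| = n -> in_facet E'.
  move=> KE' svE' nIv svG' KG' G'n; apply: contraT => badE'.
  have := maxI (E', G'); rewrite /P /= KE' badE' KG' G'n eqxx => /(_ isT).
  have : v |: I \subset E' :&: G' by rewrite subsetI svE'.
  move/subset_leq_card; rewrite cardsU1 nIv => /leq_trans le1 /le1.
  by rewrite add1n ltnn.
have badP E' : E' \in K -> ~~ in_facet E' -> forall G', G' \in K -> #|G'| = n ->
    ~~ (E' \subset G').
  move=> _ /existsPn H G' KG' G'n; apply/negP => sE'G'.
  by have := H G'; rewrite KG' sE'G' G'n eqxx.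
have [w Ew nIw] : exists2 w, w \in E & w \notin I.
  apply/subsetPn; apply: contra (badP _ KE badE _ KG Gn) => sEI.
  exact: subset_trans sEI sIG.
have ltE : (#|E| < n)%N.
  rewrite ltn_neqAle card_face_le // andbT; apply/eqP => En.
  by have := badP _ KE badE _ KE En; rewrite subxx.
have ltI : (#|I| < #|E|)%N.
  apply: proper_card; rewrite properE sIE /=; by apply/subsetPn; exists w.
have KI : I \in K by apply: Ksub KE sIE.
have linkP F' G' : F' \in K -> I \subset F' -> (G' \subset F' :\: I) ->
    G' \in link K I.
  move=> KF' sIF'; rewrite subsetD => /andP[sG' dG'].
  rewrite inE disjoint_sym dG' (Ksub _ _ KF' sG') /=.
  by apply: Ksub KF' _; rewrite subUset sIF'.
have [a Ga nIa] : exists2 a, a \in G & a \notin I.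
  apply/subsetPn; apply/negP => /subset_leq_card.
  by rewrite Gn leqNgt (ltn_trans ltI ltE).
have h0 : reduced_homology k (link K I) 0 = 0%VS.
  apply: cmK => //; rewrite /complex_dim subr_gt0 ltz_nat.
  apply: (@leq_trans #|G :\: I|); last first.
    apply: (@leq_bigmax_cond _ _ (fun G : {set V} => #|G|)).
    exact: (linkP G _ KG sIG (subxx _)).
  rewrite cardsD (setIidPr sIG) Gn ltn_subRL addn1.
  exact: leq_ltn_trans ltI ltE.
pose A := [pred v | (v \notin I) &&
  [exists G', [&& G' \in K, v |: I \subset G' & #|G'| == n]]].
have Aa : a \in A.
  by rewrite inE nIa /=; apply/existsP; exists G; rewrite KG Gn eqxx subUset sub1set Ga sIG.
have nAw : w \notin A.
  rewrite inE nIw /=; apply/existsPn => G'; apply/negP => /and3P[KG' swG' /eqP G'n].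
  have := bad_max E G' w KE; rewrite subUset sub1set Ew sIE => /(_ isT nIw swG' KG' G'n).
  by apply/negP.
(* A cycle that is not a boundary: its total coefficient on the vertices of A is 1. *)
pose c : chain k V := face_chain k [set a] - face_chain k [set w].
have Lc : c \in chains k (link K I) 0.
  by apply: memvB; apply: memv_span; apply: map_f; rewrite mem_enum inE /face_dim
    cards1 subrr eqxx andbT; [apply: (linkP G) | apply: (linkP E)];
    rewrite ?sub1set ?inE ?nIa ?nIw.
have cE H : c H = (H == [set a])%:R - (H == [set w])%:R by rewrite !ffunE.
have bc : boundary c = 0.
  apply/ffunP => H; rewrite boundaryE ffunE; have [->|/set0Pn[x Hx]] := eqVneq H set0.
    rewrite (eq_bigl xpredT) => [|v]; last by rewrite inE.
    under eq_bigr => v _.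
      rewrite vertex_pos_self ?inE // setU0 cE.
      rewrite (_ : vertex_pos _ _ = 0%N) ?expr0 ?mul1r; last first.
        by apply: eq_card0 => u; rewrite !inE.
      rewrite !(inj_eq set1_inj); over.
    rewrite sumrB (bigD1 a) //= eqxx big1 => [|v /negPf->//].
    by rewrite (bigD1 w) //= eqxx big1 ?subrr // => v /negPf->.
  apply: big1 => v nHv; rewrite cE.
  have nE u : (v |: H == [set u]) = false.
    apply/negP => /eqP/setP e; have := e x; have := e v; rewrite !inE eqxx Hx orbT /=.
    by move=> /esym/eqP ev /esym/eqP ex; rewrite ex -ev (negPf nHv) in Hx.
  by rewrite !nE subrr mulr0.
have [b Lb bE] := (homology0P _ _ _).1 h0 c Lc bc.
have : \sum_(x in A) c [set x] = 1.
  rewrite (bigD1 a) //= big1 ?addr0 => [|x /andP[Ax nxa]].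
    rewrite cE eqxx (inj_eq set1_inj); case: eqP => [eaw|]; last by rewrite subr0.
    by rewrite -eaw Aa in nAw.
  rewrite cE !(inj_eq set1_inj) (negPf nxa); case: eqP => [exw|]; last by rewrite subr0.
  by rewrite -exw Ax in nAw.
rewrite -bE; pose g x v : k := if v == x then 0 else
  (-1) ^+ (enum_rank x < enum_rank v)%N * b [set v; x].
have -> : \sum_(x in A) boundary b [set x] = \sum_(x in A) \sum_(v in A) g x v.
  apply: eq_bigr => x Ax; rewrite boundaryE [LHS]big_mkcond [RHS]big_mkcond.
  apply: eq_bigr => v _; rewrite in_set1 /g.
  case: eqP => [_|/eqP nvx] /=; first by rewrite if_same.
  rewrite vertex_pos_self ?inE // -[X in vertex_pos X]setU0 vertex_pos_setU1 ?inE //.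
  rewrite (_ : vertex_pos set0 _ = 0%N) ?addn0; last first.
    by apply: eq_card0 => u; rewrite !inE.
  case: ifP => // /negbT nAv.
  suff -> : b (v |: [set x]) = 0 by rewrite mulr0.
  move: Lb; rewrite chainsE => /supportedP; apply; apply: contra nAv.
  rewrite inE => /andP[]; rewrite inE => /and3P[_ dI KvxI] _.
  move: dI; rewrite disjoint_sym disjoints_subset subUset !sub1set !inE => /andP[nIv nIx].
  move: Ax; rewrite !inE nIv /= => /andP[_ /existsP[G' /and3P[KG' sxG' /eqP G'n]]].
  have /existsP[G'' /and3P[KG'' sG'' G''n]] : in_facet (I :|: (v |: [set x])).
    apply: (bad_max _ G' x) => //.
    by rewrite subUset subsetUl sub1set !inE eqxx !orbT.
  apply/existsP; exists G''; rewrite KG'' G''n andbT /=.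
  by apply: subset_trans sG''; rewrite subUset subsetUl sub1set !inE eqxx !orbT.
rewrite sum_antisym => [/eqP|x v|x].
- by rewrite eq_sym oner_eq0.
- rewrite /g eq_sym; case: eqP => [_|/eqP nxv]; first by rewrite oppr0.
  rewrite setUC -mulNr; congr (_ * _).
  have : enum_rank x != enum_rank v :> nat.
    by rewrite (inj_eq val_inj) (inj_eq enum_rank_inj).
  by case: ltngtP => //= _ _; rewrite ?expr0 ?expr1 ?opprK.
by rewrite /g eqxx.
Qed.

Lemma link_dim G : G \in K -> complex_dim (link K G) = n%:Z - #|G|%:Z - 1.
Proof.
move=> KG; have /existsP[F /and3P[KF sGF /eqP Fn]] := cm_pure KG.
case: cxK => _ Ksub; congr (_ - 1).
have cardD : #|F :\: G| = (n - #|G|)%N by rewrite cardsD (setIidPr sGF) Fn.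
have leG := card_face_le KG.
suff -> : (\max_(H in link K G) #|H| = n - #|G|)%N by lia.
apply/eqP; rewrite eqn_leq; apply/andP; split.
  apply/bigmax_leqP => H; rewrite inE => /and3P[_ dGH /card_face_le].
  by rewrite cardsU (disjoint_setI0 dGH) cards0; lia.
rewrite -cardD; apply: (@leq_bigmax_cond _ _ (fun G : {set V} => #|G|)).
have dGF : [disjoint G & F :\: G].
  by rewrite -setI_eq0 setIDA setDIl setDv set0I.
rewrite inE dGF (Ksub _ _ KF (subsetDl _ _)) /=.
by apply: Ksub KF _; rewrite subUset sGF subsetDl.
Qed.

End Purity.

(** * The complex of face rings *)

Section StarAcyclic.
Variables (k : fieldType) (V : finType) (K : {set {set V}}) (n : nat).
Hypotheses (cxK : simplicial_complex K) (dimK : complex_dim K = n%:Z - 1).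
Hypothesis cmK : cohen_macaulay k K.
Implicit Types (F G H : {set V}).

(** The faces that contain [G], with the boundary that only removes vertices
outside [G], form the shifted chain complex of the link of [G]. By purity its top
degree corresponds to the faces of size [n], so it is exact below. *)
Lemma star_acyclic G j (c : chain k V) : G \in K -> (j < n)%N ->
  (forall F, c F != 0 -> [&& F \in K, #|F| == j & G \subset F]) ->
  (forall F, G \subset F -> boundary c F = 0) ->
  exists2 b : chain k V,
    (forall F, b F != 0 -> [&& F \in K, #|F| == j.+1 & G \subset F]) &
    (forall F, G \subset F -> boundary b F = c F).
Proof.
move=> KG ltjn cP bc; case: (cxK) => _ Ksub.
have h0 : reduced_homology k (link K G) (j%:Z - #|G|%:Z - 1) = 0%VS.
  by apply: cmK => //; rewrite (link_dim cxK dimK cmK) // ltrD2r ltrD2r ltz_nat.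
have Lc : twist G c \in chains k (link K G) (j%:Z - #|G|%:Z - 1).
  rewrite chainsE; apply/supportedP => H; apply: contraNeq.
  rewrite ffunE inE; case: ifP => [dGH|]; last by rewrite eqxx.
  rewrite mulf_eq0 negb_or => /andP[_ /cP/and3P[KGH /eqP <- _]].
  rewrite inE dGH KGH (Ksub _ _ KGH) ?subsetUr //=.
  by rewrite /face_dim cardsU (disjoint_setI0 dGH) cards0 subn0 PoszD; apply/eqP; ring.
have bt : boundary (twist G c) = 0.
  apply/ffunP=> H; rewrite boundary_twist !ffunE bc ?subsetUl // mulr0.
  by rewrite if_same.
have [b] := (homology0P _ _ _).1 h0 _ Lc bt.
rewrite chainsE => /supportedP Lb bE.
(* A filling on the link, twisted back to the faces that contain G. *)
pose b' : chain k V := [ffun F : {set V} =>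
  if G \subset F then link_sign k G (F :\: G) * b (F :\: G) else 0].
have tb' : twist G b' = b.
  apply/ffunP=> H; rewrite !ffunE; case: ifP => [dGH|ndGH].
    rewrite subsetUl setDUl setDv set0U (setDidPl _) 1?disjoint_sym //.
    by rewrite mulrA link_sign2 mul1r.
  by rewrite Lb // !inE ndGH andbF.
exists b' => F.
  rewrite ffunE; case: ifP => [sGF|]; last by rewrite eqxx.
  rewrite mulf_eq0 negb_or => /andP[_].
  have [|/Lb->] := boolP (F :\: G \in [set H in link K G |
    face_dim H == j%:Z - #|G|%:Z - 1 + 1]); last by rewrite eqxx.
  rewrite !inE /face_dim => /andP[/and3P[_ _]].
  rewrite -[X in X :|: _](setIidPr sGF) setID => -> + _ /=.
  rewrite cardsD (setIidPr sGF); have := subset_leq_card sGF.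
  by rewrite andbT; lia.
move=> sGF; have dGF : [disjoint G & F :\: G].
  by rewrite -setI_eq0 setIDA setDIl setDv set0I.
have UF : G :|: (F :\: G) = F by rewrite -{1}(setIidPr sGF) setID.
have /ffunP/(_ (F :\: G)) : twist G (boundary b') = twist G c.
  by rewrite -boundary_twist tb'.
rewrite !ffunE dGF UF => /(congr1 (fun x => link_sign k G (F :\: G) * x)).
by rewrite !mulrA link_sign2 !mul1r.
Qed.

End StarAcyclic.

Section FaceRing.
Variables (k : fieldType) (V : finType) (K : {set {set V}}) (N : nat) (t : V -> k).
Hypothesis Ksub : forall F G : {set V}, F \in K -> G \subset F -> G \in K.
Implicit Types (F G : {set V}).

(** Exponents are cut off at [N], so that the monomials form a finite type; this
is harmless as only degrees up to [N] are used. *)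
Definition monomial := {ffun V -> 'I_N.+1}.
(** The cell [(F, m)], with [m] supported on [F], is the monomial [m] in the
summand [k[F]] of the direct sum of the polynomial rings [k[F]]. *)
Definition cell := ({set V} * monomial)%type.
Definition cell_chain := {ffun cell -> k^o}.
Implicit Types (m : monomial) (p : cell) (f : cell_chain).

Definition msupp m : {set V} := [set v | (0 < m v)%N].
Definition mdeg m : nat := (\sum_v m v)%N.
Definition mdec v m : monomial := [ffun u => if u == v then inord (m u).-1 else m u].

Lemma mdecE v m u : mdec v m u = (m u - (u == v))%N :> nat.
Proof.
rewrite ffunE; case: eqP => _ /=; rewrite ?subn0 // subn1 inordK //.
by have := ltn_ord (m u); lia.
Qed.

Lemma mdecC u v m : mdec u (mdec v m) = mdec v (mdec u m).
Proof. by apply/ffunP=> w; apply: val_inj; rewrite /= !mdecE subnAC. Qed.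

Lemma mdeg_dec v m : (0 < m v)%N -> mdeg m = (mdeg (mdec v m)).+1.
Proof.
move=> mv; rewrite /mdeg (bigD1 v) //= [in RHS](bigD1 v) //= mdecE eqxx subn1.
rewrite -addSn prednK //; congr (_ + _)%N; apply: eq_bigr => u /negPf nuv.
by rewrite mdecE nuv subn0.
Qed.

Lemma msupp_dec v m : (0 < m v)%N -> msupp m = v |: msupp (mdec v m).
Proof.
move=> mv; apply/setP=> u; rewrite !inE mdecE.
by case: eqP => [->|_] //=; rewrite subn0.
Qed.

(** Multiplication by the variable of [v]; it acts as zero on [k[F]] when [v] is
not in [F]. *)
Definition mulx (v : V) f : cell_chain :=
  [ffun p : cell => if (v \in p.1) && (0 < p.2 v)%N then f (p.1, mdec v p.2) else 0].

Lemma mulxE v f p : mulx v f p =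
  if (v \in p.1) && (0 < p.2 v)%N then f (p.1, mdec v p.2) else 0.
Proof. by rewrite ffunE. Qed.

Lemma mulx_linear v : linear (mulx v).
Proof.
move=> a f g; apply/ffunP=> p; rewrite !ffunE.
by case: ifP => // _; rewrite scaler0 addr0.
Qed.
HB.instance Definition _ v :=
  GRing.isLinear.Build k cell_chain cell_chain _ (mulx v) (mulx_linear v).

Lemma mulxC u v f : mulx u (mulx v f) = mulx v (mulx u f).
Proof.
apply/ffunP=> p; rewrite !mulxE /= mdecC !mdecE.
have [->//|nuv] := eqVneq u v.
case: (u \in p.1); case: (v \in p.1) => //=; rewrite ?if_same //.
by rewrite !subn0; case: (0 < p.2 u)%N; case: (0 < p.2 v)%N.
Qed.

Definition theta_fun c f : cell_chain := \sum_v (t v ^+ c : k) *: mulx v f.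

Lemma theta_linear c : linear (theta_fun c).
Proof.
move=> a f g; rewrite /theta_fun scaler_sumr -big_split; apply: eq_bigr => v _.
by rewrite linearP /= scalerDr !scalerA mulrC.
Qed.
HB.instance Definition _ c :=
  GRing.isLinear.Build k cell_chain cell_chain _ (theta_fun c) (theta_linear c).

Definition theta c : 'End(cell_chain) := linfun (theta_fun c).

Lemma thetaE c f : theta c f = \sum_v t v ^+ c *: mulx v f.
Proof. by rewrite lfunE. Qed.

Lemma thetaC a b f : theta a (theta b f) = theta b (theta a f).
Proof.
rewrite !thetaE.
under eq_bigr do rewrite linear_sum scaler_sumr.
under [RHS]eq_bigr do rewrite linear_sum scaler_sumr.
rewrite exchange_big; apply: eq_bigr => u _; apply: eq_bigr => v _.
by rewrite !linearZ /= !scalerA mulrC mulxC.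
Qed.

Definition slice m f : chain k V := [ffun F => f (F, m)].

(** The map induced by the restrictions [k[F] -> k[F :\ v]], with the signs of
the simplicial boundary. On the cells with a fixed monomial of support [G] it is
the boundary restricted to the faces that contain [G]. *)
Definition face_diff_fun f : cell_chain :=
  [ffun p : cell => if msupp p.2 \subset p.1 then boundary (slice p.2 f) p.1 else 0].

Lemma diff_linear : linear face_diff_fun.
Proof.
move=> a f g; apply/ffunP=> p; rewrite !ffunE.
have -> : slice p.2 (a *: f + g) = a *: slice p.2 f + slice p.2 g.
  by apply/ffunP=> F; rewrite !ffunE.
by rewrite linearP /= !ffunE; case: ifP => // _; rewrite scaler0 addr0.
Qed.
HB.instance Definition _ :=
  GRing.isLinear.Build k cell_chain cell_chain _ face_diff_fun diff_linear.

Definition face_diff : 'End(cell_chain) := linfun face_diff_fun.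

Local Notation diff := face_diff.

Lemma diffE f p : diff f p =
  if msupp p.2 \subset p.1 then
    \sum_(v | v \notin p.1) (-1) ^+ vertex_pos (v |: p.1) v * f (v |: p.1, p.2) else 0.
Proof.
rewrite lfunE ffunE boundaryE; case: ifP => // _.
by apply: eq_bigr => v _; rewrite ffunE.
Qed.

Lemma diff_boundary f p : msupp p.2 \subset p.1 ->
  diff f p = boundary (slice p.2 f) p.1.
Proof. by rewrite lfunE ffunE => ->. Qed.

Lemma diff_mulx v f : diff (mulx v f) = mulx v (diff f).
Proof.
apply/ffunP=> -[F m]; rewrite diffE ffunE /= diffE /=.
have [mv|] := boolP (0 < m v)%N; last first.
  move=> nmv; rewrite andbF; case: ifP => // _; apply: big1 => u _.
  by rewrite ffunE /= (negPf nmv) andbF mulr0.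
rewrite andbT (msupp_dec mv) subUset sub1set.
case: (boolP (v \in F)) => //= Fv; case: ifP => // _.
by apply: eq_bigr => u _; rewrite ffunE /= mv inE Fv orbT.
Qed.

Lemma diff_theta c f : diff (theta c f) = theta c (diff f).
Proof.
rewrite !thetaE linear_sum; apply: eq_bigr => v _.
by rewrite linearZ /= diff_mulx.
Qed.

Lemma diff_diff f : diff (diff f) = 0.
Proof.
apply/ffunP=> -[F m]; rewrite [RHS]ffunE.
have [sF|nsF] := boolP (msupp m \subset F); last by rewrite diffE (negPf nsF).
transitivity (boundary (boundary (slice m f)) F); last first.
  by rewrite boundary_boundary ffunE.
rewrite diff_boundary //= [LHS]boundaryE [RHS]boundaryE.
apply: eq_bigr => v _; congr (_ * _); rewrite ffunE diff_boundary //=.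
exact: subset_trans sF (subsetUr _ _).
Qed.

Definition cells j i : {set cell} :=
  [set p | [&& p.1 \in K, #|p.1| == j, msupp p.2 \subset p.1 & mdeg p.2 == i]].

Definition face_sum j i : {vspace cell_chain} := supported k (cells j i).
Definition face_cycles j i : {vspace cell_chain} := (face_sum j i :&: lker diff)%VS.
Local Notation D := face_sum.
Local Notation Z := face_cycles.

Lemma mem_face_cycles j i f : (f \in Z j i) = (f \in D j i) && (diff f == 0).
Proof. by rewrite memv_cap memv_ker. Qed.

Lemma mulx_face_sum v j i f : f \in D j i -> mulx v f \in D j i.+1.
Proof.
move=> /supportedP fD; apply/supportedP => -[F m] nFm; rewrite ffunE /=.
case: ifP => // /andP[Fv mv]; apply: fD; apply: contra nFm.
by rewrite !inE /= (msupp_dec mv) (mdeg_dec mv) eqSS subUset sub1set Fv.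
Qed.

Lemma stable_face_sum j : stable theta (D j).
Proof.
move=> b i; apply/subvP => _ /memv_imgP[f Df ->]; rewrite thetaE.
by apply: memv_suml => v _; apply: memvZ; apply: mulx_face_sum.
Qed.

Lemma stable_face_cycles j : stable theta (Z j).
Proof.
move=> b i; apply/subvP => _ /memv_imgP[f + ->]; rewrite !mem_face_cycles => /andP[Df /eqP d0].
by rewrite diff_theta d0 linear0 eqxx andbT; apply: stableP => //; apply: stable_face_sum.
Qed.

Lemma diff_face_cycles j i f : f \in D j.+1 i -> diff f \in Z j i.
Proof.
move=> /supportedP fD; rewrite mem_face_cycles diff_diff eqxx andbT.
apply/supportedP => -[F m] nFm; rewrite diffE /=; case: ifP => // sF.
apply: big1 => v nFv; rewrite fD ?mulr0 //; apply: contra nFm.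
rewrite !inE /= cardsU1 nFv add1n eqSS sF => /and4P[KF -> _ ->].
by rewrite (Ksub KF) ?subsetUr.
Qed.

Lemma lagrange v F : injective t -> v \in F ->
  exists2 p : {poly k}, (size p <= #|F|)%N &
    forall u, u \in F -> p.[t u] = (u == v)%:R.
Proof.
move=> tI Fv; pose p := \prod_(w in F :\ v) ('X - (t w)%:P).
have pv : p.[t v] != 0.
  rewrite horner_prod; apply/prodf_neq0 => w; rewrite !inE => /andP[nwv _].
  by rewrite hornerXsubC subr_eq0 (inj_eq tI) eq_sym.
exists (p.[t v]^-1 *: p).
  apply: leq_trans (size_scale_leq _ _) _.
  rewrite /p -big_enum /= size_prod_XsubC -cardE.
  by rewrite (cardsD1 v F) Fv add1n.
move=> u Fu; rewrite hornerZ; case: eqP => [->|/eqP nuv]; first by rewrite mulVf.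
suff -> : p.[t u] = 0 by rewrite mulr0.
by rewrite /p horner_prod (bigD1 u) /= ?inE ?nuv // hornerXsubC subrr mul0r.
Qed.

(** On a face [F] of size [j] each variable is a combination of
[theta 0, ..., theta j.-1]: by Lagrange interpolation some polynomial of degree
less than [j] is 1 at [t v] and 0 at the other [t u]. *)
Lemma theta_full j i : injective t -> (i < N)%N ->
  theta_part theta j (D j) i.+1 = D j i.+1.
Proof.
move=> tI ltiN; apply: subv_anti.
rewrite (theta_part_sub j i.+1 (@stable_face_sum j)) /=; apply/span_subvP => _ /mapP[[F m] + ->].
rewrite mem_enum inE /= => /and4P[KF /eqP Fj sF /eqP di].
have [v mv] : exists v, (0 < m v)%N.
  apply/existsP; apply: contraT; rewrite negb_exists => /forallP m0.
  suff : mdeg m = 0%N by rewrite di.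
  by rewrite /mdeg big1 // => v _; apply/eqP; rewrite -leqn0 leqNgt m0.
have Fv : v \in F by apply: (subsetP sF); rewrite inE.
pose e : cell_chain := delta k (F, mdec v m).
have De : e \in D j i.
  apply: memv_span; apply: map_f; rewrite mem_enum inE /= KF Fj eqxx /=.
  move: sF di; rewrite (msupp_dec mv) (mdeg_dec mv) subUset => /andP[_ ->] [->].
  exact: eqxx.
have eE : delta k (F, m) = mulx v e.
  apply/ffunP=> -[G m']; rewrite !ffunE /= !xpair_eqE.
  have [->|neG] := eqVneq G F; last by rewrite if_same.
  rewrite Fv /=; case: (posnP (m' v)) => [m'v|m'v].
    by case: eqP => // em; rewrite -em m'v in mv.
  congr (_%:R); congr nat_of_bool; apply/eqP/eqP => [->//|/ffunP em].
  apply/ffunP=> u; apply: val_inj; have /(congr1 val) := em u.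
  rewrite /= !mdecE; case: eqP => [->|_] /=; last by rewrite !subn0.
  by rewrite !subn1 => /(congr1 succn); rewrite !prednK.
have mulx0 u : u \notin F -> mulx u e = 0.
  move=> nFu; apply/ffunP=> -[G m']; rewrite !ffunE /= xpair_eqE.
  by case: eqP => [->|_]; rewrite ?(negPf nFu) //= if_same.
have [p szp pE] := lagrange tI Fv.
have -> : delta k (F, m) = \sum_(c < j) p`_c *: theta c e.
  rewrite eE; under eq_bigr do rewrite thetaE scaler_sumr.
  rewrite exchange_big /= (bigD1 v) //= [X in _ + X]big1 ?addr0.
    under eq_bigr do rewrite scalerA.
    rewrite -scaler_suml -(horner_coef_wide (n := j)) -?Fj //.
    by rewrite pE // eqxx scale1r.
  move=> u nuv; have [Fu|/mulx0->] := boolP (u \in F); last first.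
    by apply: big1 => c _; rewrite !scaler0.
  under eq_bigr do rewrite scalerA.
  rewrite -scaler_suml -(horner_coef_wide (n := j)) -?Fj //.
  by rewrite pE // (negPf nuv) scale0r.
by apply: memv_suml => c _; apply: memvZ; apply: theta_part_mem.
Qed.

End FaceRing.

(** * The reversed h-vector of a Cohen-Macaulay complex *)

Lemma quot_dim_nabla (k : fieldType) (X : vectType k) (th : nat -> 'End(X))
  (thC : forall a b x, th a (th b x) = th b (th a x)) N n (M : nat -> {vspace X}) :
  stable th M -> (forall c, (c < n)%N -> regular th N c M) ->
  forall c i, (c <= n)%N -> (i <= N)%N ->
  quot_dim th c M i = iter c nabla (fun i => (\dim (M i))%:Z) i.
Proof.
move=> sM rM; elim=> [|c IHc] i lecn leiN.
  by case: i leiN => [|i] leiN; rewrite ?quot_dim0 // /quot_dim /= big_ord0 dimv0 subr0.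
case: i leiN => [|i] leiN; rewrite iterS /nabla.
  by rewrite -(IHc 0%N (ltnW lecn)) // !quot_dim0.
rewrite -(IHc i.+1 (ltnW lecn)) // -(IHc i (ltnW lecn) (ltnW leiN)).
by rewrite (quot_dimS_regular thC sM (rM _ lecn)).
Qed.

Section Count.
Variables (V : finType) (N : nat).
Implicit Types (F : {set V}) (m : monomial V N).

Definition mset F i := [set m : monomial V N | (msupp m \subset F) && (mdeg m == i)].

Definition minc v m : monomial V N := [ffun u => if u == v then inord (m u).+1 else m u].

Lemma mincE v m u : (m v < N)%N -> minc v m u = (m u + (u == v))%N :> nat.
Proof.
move=> mv; rewrite ffunE; case: eqP => [->|_] /=; rewrite ?addn0 // addn1 inordK //.
Qed.

Lemma minc_dec v m : (m v < N)%N -> mdec v (minc v m) = m.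
Proof.
by move=> mv; apply/ffunP=> u; apply: val_inj; rewrite /= mdecE mincE // addnK.
Qed.

Lemma mdeg_ge v m : (m v <= mdeg m)%N.
Proof. by rewrite /mdeg (bigD1 v) //= leq_addr. Qed.

Lemma mset0 F : #|mset F 0| = 1%N.
Proof.
rewrite (_ : mset F 0 = [set [ffun=> ord0]]) ?cards1 //.
apply/setP=> m; rewrite !inE; apply/andP/eqP => [[_ /eqP m0]|->].
  apply/ffunP=> v; apply: val_inj; rewrite ffunE /=.
  by have := mdeg_ge v m; rewrite m0 leqn0 => /eqP.
split; first by apply/subsetP => v; rewrite inE ffunE.
by apply/eqP; apply: big1 => v _; rewrite ffunE.
Qed.

(** Pascal's recursion: split the monomials by whether they are divisible by the
variable of a chosen vertex. *)
Lemma card_mset F i : (i <= N)%N -> #|mset F i| = nmonom #|F| i.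
Proof.
elim: {F}_.+1 {-2}F (ltnSn #|F|) i => // s IHs F ltFs; elim=> [|i IHi] leiN.
  by rewrite mset0 nmonom0.
have [->|[v Fv]] := set_0Vmem F.
  rewrite cards0 nmonom0S; apply: eq_card0 => m; rewrite !inE subset0.
  apply/negP => /andP[/eqP/setP m0]; rewrite /mdeg big1 // => v _.
  by have := m0 v; rewrite !inE lt0n => /negbFE/eqP.
have FE : #|F| = #|F :\ v|.+1 by rewrite (cardsD1 v) Fv.
rewrite FE nmonomSS -FE -(IHi (ltnW leiN)) -IHs //; last by rewrite -FE in ltFs *; lia.
rewrite -(cardsID [set m : monomial V N | (0 < m v)%N]) addnC; congr (_ + _)%N.
  apply: eq_card => m; rewrite !inE subsetD1 inE.
  by case: (0 < m v)%N; rewrite ?andbF ?andbT.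
rewrite -(card_in_imset (f := mdec v)) => [|m m']; last first.
  rewrite !inE => /andP[_ mv] /andP[_ m'v] /ffunP em; apply/ffunP=> u; apply: val_inj.
  have /(congr1 val) := em u; rewrite /= !mdecE; case: eqP => [->|_] /=.
    by rewrite !subn1 => /(congr1 succn); rewrite !prednK.
  by rewrite !subn0.
apply: eq_card => m; apply/imsetP/idP => [[m' + ->]|].
  rewrite !inE => /andP[/andP[+ +] m'v]; rewrite (msupp_dec m'v) (mdeg_dec m'v).
  by rewrite subUset eqSS => /andP[_ ->].
rewrite !inE => /andP[sF /eqP di]; have mv : (m v < N)%N.
  by apply: leq_ltn_trans leiN; rewrite -di mdeg_ge.
have iv : (0 < minc v m v)%N by rewrite mincE // eqxx addn1.
exists (minc v m); last by rewrite minc_dec.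
rewrite !inE iv (msupp_dec iv) (mdeg_dec iv) minc_dec // subUset sub1set Fv sF.
by rewrite di eqxx.
Qed.

End Count.

Definition face_count (V : finType) (K : {set {set V}}) j :=
  #|[set F in K | #|F| == j]|.

Section HVector.
Variables (k : fieldType) (V : finType) (K : {set {set V}}) (n N : nat) (t : V -> k).
Hypotheses (cxK : simplicial_complex K) (dimK : complex_dim K = n%:Z - 1).
Hypothesis cmK : cohen_macaulay k K.
Hypothesis tI : injective t.
Implicit Types (F G : {set V}).
Let Ksub : forall F G, F \in K -> G \subset F -> G \in K := cxK.2.
Local Notation D := (@face_sum k V K N).
Local Notation Z := (@face_cycles k V K N).
Local Notation diff := (@face_diff k V N).
Local Notation theta := (@theta k V N t).

Lemma dim_face_sum j i : (i <= N)%N -> \dim (D j i) = (face_count K j * nmonom j i)%N.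
Proof.
move=> leiN; rewrite dim_supported -sum1_card.
rewrite (eq_bigl (fun p : cell V N => (p.1 \in [set F in K | #|F| == j]) &&
   (p.2 \in mset N p.1 i))); last by move=> p; rewrite !inE -!andbA.
rewrite -(pair_big_dep (mem [set F in K | #|F| == j])
  (fun F m => m \in mset N F i) (fun _ _ => 1%N)) /=.
rewrite -sum_nat_const; apply: eq_bigr => F; rewrite inE => /andP[_ /eqP <-].
by rewrite sum1_card card_mset.
Qed.

(** For each monomial separately this is the exactness of a star. *)
Lemma diff_surj j i f : (j < n)%N -> f \in Z j i ->
  exists2 g, g \in D j.+1 i & diff g = f.
Proof.
move=> ltjn; rewrite mem_face_cycles => /andP[/supportedP Df /eqP df].
have Dfm F m : f (F, m) != 0 -> [&& F \in K, #|F| == j, msupp m \subset F & mdeg m == i].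
  by apply: contraR => nFm; rewrite Df // inE.
pose P m (c : chain k V) :=
  (forall F, c F != 0 -> [&& F \in K, #|F| == j.+1, msupp m \subset F & mdeg m == i]) /\
  (forall F, msupp m \subset F -> boundary c F = f (F, m)).
have /fin_all_exists[c cP] : forall m : monomial V N, exists c, P m c.
  move=> m; have [/andP[Km /eqP di]|nKm] := boolP ((msupp m \in K) && (mdeg m == i)).
    have [|F sF|b bP bE] := star_acyclic cxK dimK cmK (c := slice m f) Km ltjn.
    - by move=> F; rewrite ffunE => /Dfm/and4P[-> -> ->].
    - by have := @diff_boundary k V N f (F, m) sF; rewrite df ffunE.
    exists b; split=> F; first by move/bP; rewrite di eqxx andbT.
    by move=> sF; rewrite bE // ffunE.
  exists 0; split=> F; first by rewrite ffunE eqxx.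
  move=> sF; rewrite linear0 ffunE; apply/esym/eqP; apply: contraNT nKm.
  by move=> /Dfm/and4P[KF _ _ ->]; rewrite andbT; apply: Ksub KF sF.
exists [ffun p => c p.2 p.1].
  apply/supportedP => -[F m]; rewrite inE ffunE /= => nFm; apply/eqP.
  by apply: contraNT nFm => /((cP m).1 F).
apply/ffunP=> -[F m]; have [sF|nsF] := boolP (msupp m \subset F); last first.
  rewrite diffE (negPf nsF); apply/esym/eqP; apply: contraNT nsF.
  by move=> /Dfm/and4P[_ _ ->].
rewrite diff_boundary //= -(cP m).2 //; congr (boundary _ _).
by apply/ffunP=> G; rewrite !ffunE.
Qed.

Lemma dim_face_cycles j i : (j <= n)%N -> (i <= N)%N -> (\dim (Z j i))%:Z =
  \sum_(l < j.+1) ((-1) ^+ (j - l) * (face_count K l)%:Z) * (nmonom l i)%:Z.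
Proof.
move=> + leiN; elim: j => [|j IHj] lejn.
  rewrite big_ord1 mul1r -PoszM -dim_face_sum // (_ : Z 0 i = D 0 i) //.
  apply/vspaceP => f; rewrite mem_face_cycles; case: (boolP (f \in _)) => //= /supportedP Df.
  apply/eqP/ffunP=> -[F m]; rewrite diffE [RHS]ffunE; case: ifP => // _.
  apply: big1 => v nFv; rewrite Df ?mulr0 // inE /= cards_eq0.
  by rewrite -subset0 subUset sub1set inE andbF.
have := limg_ker_dim diff (D j.+1 i); rewrite -/(Z j.+1 i).
have -> : (diff @: D j.+1 i = Z j i)%VS.
  apply/vspaceP => f; apply/memv_imgP/idP => [[g Dg ->]|/(diff_surj lejn)[g Dg <-]].
    exact: (diff_face_cycles Ksub).
  by exists g.
rewrite dim_face_sum // big_ord_recr /= subnn expr0 mul1r -PoszM => <-; rewrite PoszD.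
rewrite (_ : \sum_(l < j.+1) _ = - (\dim (Z j i))%:Z) 1?addrC ?addrK //.
rewrite (IHj (ltnW lejn)) -sumrN; apply: eq_bigr => l _.
by rewrite subSn -1?ltnS // exprS; ring.
Qed.

(** Induction on [j] with the depth lemma, applied to
[0 -> Z j.+1 -> D j.+1 -> Z j -> 0]. *)
Lemma regular_face_cycles j c : (j <= n)%N -> (c < j)%N -> regular theta N c (Z j).
Proof.
elim: j c => // j IHj c lejn lecj.
apply: (@regular_kernel _ _ _ (thetaC t) N j diff (D j.+1) (Z j.+1) (Z j)) => //.
- by move=> b x; rewrite diff_theta.
- exact: stable_face_sum.
- exact: stable_face_cycles.
- by move=> i x; apply: mem_face_cycles.
- by move=> i x; apply: (diff_face_cycles Ksub).
- by move=> i y _; apply: diff_surj.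
- move=> c' lec'; apply: (@regular_of_dim _ _ _ (thetaC t) N j.+1 (face_count K j.+1)) => //.
  + exact: stable_face_sum.
  + by move=> i; apply: dim_face_sum.
  by move=> i; apply: theta_full.
- by move=> c' ltc'; apply: IHj => //; apply: ltnW.
Qed.

Lemma h_rev_ge0_inj i : (i <= N)%N -> 0 <= \sum_(l < n.+1)
  ((-1) ^+ (n - l) * (face_count K l)%:Z) * ((-1) ^+ i * ('C(n - l, i))%:Z).
Proof.
move=> leiN.
have := quot_dim_ge0 n i (@stable_face_cycles k V K N t n).
rewrite (quot_dim_nabla (thetaC t) (N := N) (n := n)) //; last first.
- by move=> c; apply: regular_face_cycles.
- exact: stable_face_cycles.
rewrite (eq_nabla _ (N := N) (g' := fun i => \sum_(l < n.+1)
  ((-1) ^+ (n - l) * (face_count K l)%:Z) * (nmonom l i)%:Z)) //; last first.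
  by move=> i' lei'; rewrite dim_face_cycles.
rewrite iter_nabla_sum.
by under eq_bigr => l _ do rewrite iter_nabla_nmonom_gt ?leq_ord //.
Qed.

End HVector.

(** The entry [h_(n - i)] of the h-vector of a complex of dimension [n - 1],
as it comes out of the Hilbert function of the kernel of [D n -> D n.-1] divided
by [n] linear forms: the h-vector appears in reversed order there. *)
Definition h_rev (V : finType) (K : {set {set V}}) n i : int := \sum_(l < n.+1)
  ((-1) ^+ (n - l) * (face_count K l)%:Z) * ((-1) ^+ i * ('C(n - l, i))%:Z).

(** The number is a dimension once there are enough scalars to choose distinct
[t v]; a finite field is first replaced by the rational functions over it. *)
Lemma h_rev_ge0 (k : fieldType) (V : finType) (K : {set {set V}}) (n i : nat) :
  simplicial_complex K -> complex_dim K = n%:Z - 1 -> cohen_macaulay k K ->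
  0 <= h_rev K n i.
Proof.
move=> cxK dimK cmK; pose k' := {fraction {poly k}}.
pose t (v : V) : k' := tofrac ('X ^+ enum_rank v).
apply: (@h_rev_ge0_inj k' V K n i t) => //.
  exact: (cohen_macaulay_map ((@tofrac {poly k}) \o (@polyC k))).
move=> u v /eqP; rewrite tofrac_eq => /eqP/(congr1 (fun p : {poly k} => size p)).
by rewrite !size_polyXn => -[] /val_inj/enum_rank_inj.
Qed.

(** * The face numbers from the h-vector *)

Lemma sum_bin_bin a b n : (a <= n)%N ->
  \sum_(i < n.+1) (-1) ^+ i * ('C(a, i) * 'C(i, b))%N%:Z = (-1) ^+ a * (a == b)%:Z.
Proof.
move=> lean.
have sgE e : (-1) ^+ e = ((-1) ^+ e)%:P :> {poly int}.
  by rewrite rmorphXn /= rmorphN1.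
(* The sum is the coefficient of 'X^b in the binomial expansion of (1 - (1 + 'X)) ^+ a. *)
have /(congr1 (fun p : {poly int} => p`_b)) : (1 - (1 + 'X)) ^+ a = (- 'X) ^+ a :> {poly int}.
  by rewrite opprD addNKr.
rewrite [in RHS]exprNn sgE mul_polyC coefZ coefXn eq_sym natz.
move=> <-; rewrite exprDn coef_sum.
rewrite (big_ord_widen n.+1 (fun i => (1 ^+ (a - i) * (- (1 + 'X)) ^+ i *+ 'C(a, i) : {poly int})`_b)) //.
rewrite [RHS]big_mkcond /=; apply: eq_bigr => i _; rewrite ltnS.
case: leqP => [leia|ltai]; last by rewrite bin_small // mul0n mulr0.
rewrite expr1n mul1r [in RHS]exprNn sgE mul_polyC coefMn coefZ.
have -> : ((1 + 'X : {poly int}) ^+ i)`_b = ('C(i, b))%:Z.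
  rewrite exprDn coef_sum; under eq_bigr do rewrite expr1n mul1r coefMn coefXn.
  have [leb|ltb] := leqP b i.
    rewrite (bigD1 (Ordinal (leb : (b < i.+1)%N))) //= eqxx big1 ?addr0 ?natz //.
    move=> j; rewrite -val_eqE /= eq_sym => /negPf ->; exact: mul0rn.
  rewrite bin_small // big1 // => j _; case: eqP => [ej|]; last by rewrite mul0rn.
  by have := ltn_ord j; rewrite -ej ltnS leqNgt ltb.
by rewrite PoszM -mulr_natr natz; ring.
Qed.

Lemma face_count_h (V : finType) (K : {set {set V}}) n m : (m <= n)%N ->
  (face_count K m)%:Z = \sum_(i < n.+1) h_rev K n i * ('C(i, n - m))%:Z.
Proof.
move=> lemn; rewrite /h_rev; under eq_bigr do rewrite mulr_suml.
rewrite exchange_big /= (bigD1 (Ordinal (lemn : (m < n.+1)%N))) //= [X in _ + X]big1 ?addr0.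
  rewrite (eq_bigr (fun i : 'I_n.+1 => ((-1) ^+ (n - m) * (face_count K m)%:Z) *
      ((-1) ^+ i * ('C(n - m, i) * 'C(i, n - m))%N%:Z))); last first.
    by move=> i _; rewrite PoszM /=; ring.
  rewrite -mulr_sumr sum_bin_bin ?leq_subr // eqxx mulr1 mulrAC -exprD addnn -mul2n.
  by rewrite exprM sqrrN !expr1n mul1r.
move=> l nlm.
rewrite (eq_bigr (fun i : 'I_n.+1 => ((-1) ^+ (n - l) * (face_count K l)%:Z) *
    ((-1) ^+ i * ('C(n - l, i) * 'C(i, n - m))%N%:Z))); last first.
  by move=> i _; rewrite PoszM /=; ring.
rewrite -mulr_sumr sum_bin_bin ?leq_subr //.
rewrite (_ : (n - l == n - m)%N = false) ?mulr0 //.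
apply: contraNF nlm; rewrite -val_eqE /= => /eqP e; apply/eqP.
by rewrite -(subKn lemn) -e subKn // -ltnS.
Qed.

(** * Maximal chains of rank-selected face posets *)

Section Flags.
Variables (d : nat).
Implicit Types (T : {set 'I_d.+1}).

(** The chains with exactly one face of each rank in [T]. *)
Definition flags (V : finType) T : {set {set {set V}}} :=
  [set C in order_complex [set: {set V}] |
    [forall F in C, exists i in T, #|F| == i] && (#|C| == #|T|)].

Definition top_rank T : nat := \max_(i in T) i.

Variable V : finType.
Implicit Types (C K : {set {set V}}) (F G : {set V}).

Definition ranked T C := {in C, forall F, exists2 i, i \in T & #|F| = i}.
Definition chainp C := {in C &, forall F G, F \subset G \/ G \subset F}.

Lemma order_complexP K C :
  reflect (C \subset K /\ chainp C) (C \in order_complex K).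
Proof.
rewrite inE; apply: (iffP andP) => -[sCK chC]; split=> //.
  move=> F G CF CG; have /forall_inP/(_ F CF)/forall_inP/(_ G CG) := chC.
  by case/orP; [left | right].
apply/forall_inP => F CF; apply/forall_inP => G CG; apply/orP.
by have [] := chC F G CF CG; [left | right].
Qed.

Lemma rankedP T C : reflect (ranked T C) [forall F in C, exists i in T, #|F| == i].
Proof.
apply: (iffP forall_inP) => rC F /rC.
  by case/exists_inP=> i Ti /eqP; exists i.
by case=> i Ti Fi; apply/exists_inP; exists i; rewrite ?Fi.
Qed.

Lemma flagsP T C :
  reflect [/\ chainp C, ranked T C & #|C| = #|T|] (C \in flags V T).
Proof.
rewrite inE; apply: (iffP and3P) => [[/order_complexP[_ ?] /rankedP ? /eqP]|].
  by split.
by case=> chC rC eC; split; [apply/order_complexP; rewrite subsetT | apply/rankedP | apply/eqP].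
Qed.

Lemma chain_sub C F G : chainp C -> F \in C -> G \in C -> (#|F| <= #|G|)%N -> F \subset G.
Proof.
move=> chC CF CG leFG; have [//|sGF] := chC F G CF CG.
by have/eqP-> : G == F by rewrite eqEcard sGF.
Qed.

Lemma rank_inj C T : chainp C -> ranked T C ->
  {in C &, injective (fun F => inord #|F| : 'I_d.+1)}.
Proof.
move=> chC rC F G CF CG; have [i _ Fi] := rC F CF; have [j _ Gj] := rC G CG.
rewrite Fi Gj !inord_val => eij; rewrite -eij in Gj.
by apply/eqP; rewrite eqEsubset !(chain_sub chC) // ?Fi ?Gj.
Qed.

Lemma rank_sub C T : ranked T C -> (fun F => inord #|F| : 'I_d.+1) @: C \subset T.
Proof.
by move=> rC; apply/subsetP => _ /imsetP[F /rC[i Ti ->] ->]; rewrite inord_val.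
Qed.

Lemma chain_card T C : chainp C -> ranked T C -> (#|C| <= #|T|)%N.
Proof.
move=> chC rC; rewrite -(card_in_imset (rank_inj chC rC)).
exact: subset_leq_card (rank_sub rC).
Qed.

Lemma flag_rank T C i : C \in flags V T -> i \in T -> exists2 F, F \in C & #|F| = i.
Proof.
case/flagsP=> chC rC eC Ti.
have /eqP eT : (fun F => inord #|F| : 'I_d.+1) @: C == T.
  by rewrite eqEcard rank_sub //= (card_in_imset (rank_inj chC rC)) eC.
move: Ti; rewrite -eT => /imsetP[F CF ->]; exists F => //.
by have [j _ ->] := rC F CF; rewrite inord_val.
Qed.

Lemma rank_selectedP K T F : reflect (F \in K /\ exists2 i, i \in T & #|F| = i)
  (F \in rank_selected K T).
Proof.
rewrite inE; apply: (iffP andP) => -[KF].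
  by case/exists_inP=> i Ti /eqP; split=> //; exists i.
by case=> i Ti Fi; split=> //; apply/exists_inP; exists i; rewrite ?Fi.
Qed.

Lemma subset_between (A E : {set V}) t : A \subset E -> (#|A| <= t <= #|E|)%N ->
  exists F : {set V}, [/\ A \subset F, F \subset E & #|F| = t].
Proof.
move=> sAE /andP[leAt letE].
have /card_gt0P[B] : (0 < #|[set B : {set V} | B \subset E :\: A & #|B| == t - #|A|]%N|)%N.
  by rewrite cards_draws bin_gt0 cardsD (setIidPr sAE) leq_sub2r.
rewrite inE => /andP[sB /eqP cB]; exists (A :|: B); rewrite subsetUl subUset sAE.
rewrite (subset_trans sB (subsetDl _ _)) cardsU; split=> //.
rewrite (_ : A :&: B = set0) ?cards0 ?cB; first by lia.
apply/eqP; rewrite setI_eq0 disjoint_sym; move: sB.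
by rewrite subsetD => /andP[].
Qed.

Lemma flag_cover T C : C \in flags V T -> #|cover C| = top_rank T.
Proof.
move=> flC; have /flagsP[chC rC eC] := flC.
have [T0|[i0 Ti0]] := set_0Vmem T.
  have /eqP -> : C == set0 by rewrite -cards_eq0 eC T0 cards0.
  by rewrite /cover big_set0 cards0 /top_rank T0 big_set0.
have T_gt0 : (0 < #|T|)%N by apply/card_gt0P; exists i0.
have [i Ti mi] := eq_bigmax_cond (fun i : 'I_d.+1 => i : nat) (A := mem T) T_gt0.
have [F CF Fi] := flag_rank flC Ti; rewrite /top_rank mi -Fi.
suff -> : cover C = F by [].
apply/eqP; rewrite eqEsubset (bigcup_sup F) // andbT; apply/bigcupsP => G CG.
apply: (chain_sub chC) => //; have [j Tj ->] := rC G CG.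
by rewrite Fi -mi; apply: (@leq_bigmax_cond _ (mem T) (fun i : 'I_d.+1 => i : nat)).
Qed.

Lemma flag_cover_sub K T C : set0 \in K ->
  (forall F G, F \in K -> G \subset F -> G \in K) ->
  C \in flags V T -> (C \subset K) = (cover C \in K).
Proof.
move=> K0 Ksub flC; have /flagsP[chC rC eC] := flC.
apply/subsetP/idP => [sCK|Kc F CF]; last by apply: Ksub Kc _; apply: (bigcup_sup F).
have [T0|[i0 Ti0]] := set_0Vmem T.
  have /eqP -> : C == set0 by rewrite -cards_eq0 eC T0 cards0.
  by rewrite /cover big_set0.
have T_gt0 : (0 < #|T|)%N by apply/card_gt0P; exists i0.
have [i Ti mi] := eq_bigmax_cond (fun i : 'I_d.+1 => i : nat) (A := mem T) T_gt0.
have [F CF Fi] := flag_rank flC Ti.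
suff -> : cover C = F by apply: sCK.
apply/esym/eqP; rewrite eqEcard (bigcup_sup F) //= (flag_cover flC).
by rewrite /top_rank mi Fi.
Qed.

Definition flags_over T F := [set C in flags V T | cover C == F].

(** The union of a flag is its top face, or empty if the flag is, so all unions
have size [top_rank T]. *)
Lemma card_flags (P : {pred {set V}}) T N :
  (forall F, F \in P -> #|F| = top_rank T -> #|flags_over T F| = N) ->
  #|[set C in flags V T | cover C \in P]| = (#|[set F in P | #|F| == top_rank T]| * N)%N.
Proof.
move=> cN; rewrite -sum_nat_const -sum1_card.
rewrite (partition_big (@cover V) (mem [set F in P | #|F| == top_rank T])) /=; last first.
  by move=> C; rewrite inE => /andP[flC PC]; rewrite inE PC (flag_cover flC) eqxx.
apply: eq_bigr => F; rewrite inE => /andP[PF /eqP Fm]; rewrite -(cN F PF Fm) -sum1_card.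
apply: eq_bigl => C; rewrite [in LHS]in_set [RHS]in_set -andbA.
case: (C \in flags V T) => //=.
by case: eqP => [->|_]; rewrite ?andbF ?andbT.
Qed.

Section Pure.
Variables (K : {set {set V}}).
Hypothesis K0 : set0 \in K.
Hypothesis Ksub : forall F G, F \in K -> G \subset F -> G \in K.
Hypothesis Kpure : forall F, F \in K -> exists G, [/\ G \in K, F \subset G & #|G| = d.+1].

(** A chain that misses a rank [t] can be refined: a face [F] of size [t] fits
between the largest smaller member [A] and the smallest larger member, or, if
there is none, a face of size [d.+1] that contains [A]; this last case needs
purity. *)
Lemma maximal_flags T :
  maximal_chains (rank_selected K T) = [set C in flags V T | C \subset K].
Proof.
apply/setP => C; rewrite [LHS]in_set [RHS]in_set; apply/maxsetP/andP => [[]|[]].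
  move=> /order_complexP[sCK chC] maxC.
  have rC : ranked T C by move=> F /(subsetP sCK)/rank_selectedP[].
  have sCK' : C \subset K by apply/subsetP=> F /(subsetP sCK)/rank_selectedP[].
  split=> //; apply/flagsP; split=> //; apply/eqP; rewrite eqn_leq chain_card //= leqNgt; apply/negP => ltC.
  have [t Tt nCt] : exists2 t, t \in T & t \notin (fun F => inord #|F| : 'I_d.+1) @: C.
    apply/subsetPn; apply: contraL ltC => /subset_leq_card.
    by rewrite (card_in_imset (rank_inj chC rC)) leqNgt.
  have nCt' F : F \in C -> #|F| != t.
    move=> CF; apply: contra nCt => /eqP Ft; apply/imsetP; exists F => //.
    by rewrite Ft inord_val.
  have [A [KA leAt lowA upA]] : exists A, [/\ A \in K, (#|A| <= t)%N,
      (forall F, F \in C -> (#|F| < t)%N -> F \subset A) &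
      (forall F, F \in C -> (t < #|F|)%N -> A \subset F)].
    have [/setP none|[F0 CF0]] := set_0Vmem [set F in C | (#|F| < t)%N].
      exists set0; rewrite K0 cards0 leq0n; split=> // F CF ltF; last exact: sub0set.
      by have := none F; rewrite !inE CF ltF.
    pose P := [pred F : {set V} | (F \in C) && (#|F| < t)%N].
    have PF0 : P F0 by move: CF0; rewrite inE.
    case: (@arg_maxnP _ F0 P (fun F => #|F|) PF0) => A /andP[CA ltA] maxA.
    exists A; rewrite (subsetP sCK') // ltnW //; split=> // F CF ltF.
      by apply: (chain_sub chC) => //; apply: maxA; rewrite /= CF.
    by apply: (chain_sub chC) => //; apply: ltnW; apply: ltn_trans ltF.
  have [E [KE leEt sAE upE]] : exists E, [/\ E \in K, (t <= #|E|)%N, A \subset E &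
      (forall F, F \in C -> (t < #|F|)%N -> E \subset F)].
    have [/setP none|[F0 CF0]] := set_0Vmem [set F in C | (t < #|F|)%N].
      have [G [KG sAG Gd]] := Kpure KA; exists G; rewrite KG Gd ltnW //.
      by split=> // F CF ltF; have := none F; rewrite !inE CF ltF.
    pose P := [pred F : {set V} | (F \in C) && (t < #|F|)%N].
    have PF0 : P F0 by move: CF0; rewrite inE.
    case: (@arg_minnP _ F0 P (fun F => #|F|) PF0) => E /andP[CE ltE] minE.
    exists E; rewrite (subsetP sCK') // ltnW // upA //; split=> // F CF ltF.
    by apply: (chain_sub chC) => //; apply: minE; rewrite /= CF.
  have [|F [sAF sFE Ft]] := subset_between sAE (t := t); first by rewrite leAt.
  have KF := Ksub KE sFE.
  have cmp G : G \in C -> F \subset G \/ G \subset F.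
    move=> CG; have := nCt' G CG; case: ltngtP => // ltG _.
      by right; apply: subset_trans (lowA G CG ltG) sAF.
    by left; apply: subset_trans sFE (upE G CG ltG).
  have CF : F \in C.
    rewrite -(maxC (F |: C)) ?setU11 ?subsetUr //; apply/order_complexP; split.
      rewrite subUset sub1set sCK andbT; apply/rank_selectedP; split=> //.
      by exists t.
    move=> G H /setU1P[->|CG] /setU1P[->|CH]; [by left | exact: cmp | | exact: chC].
    by case: (cmp G CG); [right | left].
  by have := nCt' F CF; rewrite Ft eqxx.
move=> /flagsP[chC rC eC] sCK; split=> [|C' ].
  apply/order_complexP; split=> //; apply/subsetP => F CF.
  by apply/rank_selectedP; split; [apply: (subsetP sCK) | apply: rC].
move=> /order_complexP[sC' chC'] sCC'; apply/esym/eqP.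
rewrite eqEcard sCC' eC chain_card // => F /(subsetP sC')/rank_selectedP[] //.
Qed.

End Pure.
End Flags.

Section Transport.
Variables (d : nat) (T : {set 'I_d.+1}).

(** Together with the symmetric inequality it shows that the number of flags
below a face only depends on its size, even across different vertex sets. *)
Lemma flags_over_le (V W : finType) (f : V -> W) (F : {set V}) :
  {in F &, injective f} -> (#|flags_over T F| <= #|flags_over T (f @: F)|)%N.
Proof.
move=> fI; pose h (B : {set W}) : {set V} := [set x in F | f x \in B].
have fK (G : {set V}) : G \subset F -> h (f @: G) = G.
  move=> sGF; apply/setP=> x; rewrite inE; apply/andP/idP => [[Fx /imsetP[y Gy exy]]|Gx].
    by rewrite (fI x y) // (subsetP sGF).
  by rewrite (subsetP sGF) // imset_f.
pose phi (C : {set {set V}}) := (fun G : {set V} => f @: G) @: C.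
have flF C : C \in flags_over T F -> {in C, forall G : {set V}, G \subset F}.
  by rewrite inE => /andP[_ /eqP <-] G CG; apply: (bigcup_sup G).
have phiK : {in flags_over T F, cancel phi (fun B => h @: B)}.
  move=> C flC; apply/setP=> G; rewrite /phi -imset_comp; apply/imsetP/idP.
    by case=> H CH ->; rewrite /= fK // (flF C).
  by move=> CG; exists G; rewrite //= fK // (flF C).
rewrite -(card_in_imset (can_in_inj phiK)); apply: subset_leq_card.
apply/subsetP=> _ /imsetP[C flC ->]; have sCF := flF C flC.
have cardf (G : {set V}) : G \in C -> #|f @: G| = #|G|.
  move=> /sCF/subsetP sGF; apply: card_in_imset => x y Gx Gy; apply: fI; exact: sGF.
move: flC; rewrite inE => /andP[/flagsP[chC rC eC] /eqP covC].
rewrite inE; apply/andP; split; last first.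
  apply/eqP/setP=> y; apply/bigcupP/imsetP => [[_ /imsetP[G CG ->] /imsetP[x Gx ->]]|].
    by exists x; rewrite // (subsetP (sCF G CG)).
  case=> x; rewrite -covC => /bigcupP[G CG Gx] ->.
  by exists (f @: G); apply: imset_f.
apply/flagsP; split.
- move=> _ _ /imsetP[G CG ->] /imsetP[H CH ->].
  by have [sGH|sGH] := chC G H CG CH; [left | right]; apply: imsetS.
- by move=> _ /imsetP[G CG ->]; rewrite cardf //; apply: rC.
rewrite -eC; apply: card_in_imset => G H CG CH e.
by rewrite -(fK G) ?sCF // e fK ?sCF.
Qed.

Lemma ex_imset (V W : finType) (w0 : W) (F : {set V}) (A : {set W}) : #|F| = #|A| ->
  exists2 f : V -> W, {in F &, injective f} & f @: F = A.
Proof.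
move=> eFA; pose f x := nth w0 (enum A) (index x (enum F)).
have ltf x : x \in F -> (index x (enum F) < size (enum A))%N.
  by move=> Fx; rewrite -cardE -eFA cardE index_mem mem_enum.
have fI : {in F &, injective f}.
  move=> x y Fx Fy /eqP; rewrite /f nth_uniq ?ltf ?enum_uniq // => /eqP exy.
  by rewrite -(nth_index x (_ : x \in enum F)) ?mem_enum // exy nth_index ?mem_enum.
exists f => //; apply/eqP; rewrite eqEcard card_in_imset // eFA leqnn andbT.
by apply/subsetP=> _ /imsetP[x Fx ->]; rewrite -mem_enum mem_nth ?ltf.
Qed.

Lemma card_flags_over (V W : finType) (v0 : V) (w0 : W) (F : {set V}) (A : {set W}) :
  #|F| = #|A| -> #|flags_over T F| = #|flags_over T A|.
Proof.
move=> eFA; apply/eqP; rewrite eqn_leq.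
have [f fI fE] := ex_imset w0 eFA; have [g gI gE] := ex_imset v0 (esym eFA).
by rewrite -{1}fE flags_over_le // -gE flags_over_le.
Qed.

End Transport.

(** * Permutations as complete flags of subsets *)

Section PermFlags.
Variable d : nat.
Implicit Types (T : {set 'I_d.+1}) (s : 'S_d.+1) (C : {set {set 'I_d.+1}}).
Implicit Types (x y : 'I_d.+1).

Definition initial (t : nat) : {set 'I_d.+1} := [set x : 'I_d.+1 | (x < t)%N].
(** The sets formed by the first [t] letters of the word of [s], for [t] in [T].
This is a bijection from the permutations with descents in [T] to the flags of
type [T]: the inverse lists the letters block by block, increasingly within each
block. *)
Definition perm_flag T s : {set {set 'I_d.+1}} :=
  [set s @: initial (t : 'I_d.+1) | t in T].
Definition level C x := #|[set A in C | x \notin A]|.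
(** Orders the letters first by the block of the flag [C] in which they appear,
then by value; the factor [d.+1] exceeds every letter. *)
Definition key C x := (level C x * d.+1 + x)%N.

Lemma card_initial t : (t <= d.+1)%N -> #|initial t| = t.
Proof.
move=> let_; rewrite -sum1_card (eq_bigl (fun x : 'I_d.+1 => (x < t)%N)).
  by rewrite -(big_ord_widen d.+1 (fun=> 1%N)) // sum1_card card_ord.
by move=> x; rewrite inE.
Qed.

Lemma mem_perm_initial s x t : (s x \in s @: initial t) = (x < t)%N.
Proof. by rewrite mem_imset ?inE //; apply: perm_inj. Qed.

Lemma key_inj C : injective (key C).
Proof.
move=> x y /(congr1 (modn^~ d.+1)); rewrite /key !modnMDl !modn_small //.
exact: val_inj.
Qed.

Lemma key_lt_level C x y : (level C x < level C y)%N -> (key C x < key C y)%N.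
Proof.
move=> ltl; rewrite /key; apply: (@leq_trans ((level C x).+1 * d.+1)).
  by rewrite mulSn addnC ltn_add2r.
by apply: leq_trans (leq_addr _ _); rewrite leq_mul2r ltl orbT.
Qed.

Lemma key_lt_letter C x y : (level C x <= level C y)%N -> (x < y)%N ->
  (key C x < key C y)%N.
Proof. by move=> lel ltxy; rewrite /key -addnS leq_add // leq_mul2r lel orbT. Qed.

Lemma level_le_sub C x y : {in C, forall A : {set 'I_d.+1}, y \in A -> x \in A} ->
  (level C x <= level C y)%N.
Proof.
move=> H; apply: subset_leq_card; apply/subsetP=> A; rewrite !inE => /andP[CA].
by rewrite CA /=; apply: contra; apply: H.
Qed.

Lemma level_lt_sub C x y (A : {set 'I_d.+1}) :
  {in C, forall A : {set 'I_d.+1}, y \in A -> x \in A} ->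
  A \in C -> x \in A -> y \notin A -> (level C x < level C y)%N.
Proof.
move=> H CA Ax nAy; apply: proper_card; rewrite properE; apply/andP; split.
  apply/subsetP=> B; rewrite !inE => /andP[CB].
  by rewrite CB /=; apply: contra; apply: H.
by apply/subsetPn; exists A; rewrite !inE CA ?Ax ?nAy.
Qed.

Lemma perm_flag_initial T s x y : (x <= y)%N ->
  {in perm_flag T s, forall A : {set 'I_d.+1}, s y \in A -> s x \in A}.
Proof.
by move=> lexy _ /imsetP[t _ ->]; rewrite !mem_perm_initial; apply: leq_ltn_trans.
Qed.

Lemma card_perm_initial s (t : 'I_d.+1) : #|s @: initial t| = t.
Proof. by rewrite card_imset ?card_initial //; [apply: ltnW | apply: perm_inj]. Qed.

Lemma perm_flag_flags T s : perm_flag T s \in flags _ T.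
Proof.
apply/flagsP; split.
- move=> _ _ /imsetP[t _ ->] /imsetP[u _ ->].
  by have [letu|leut] := leqP t u; [left | right]; apply: imsetS;
    apply/subsetP=> x; rewrite !inE => /leq_trans; apply; rewrite ?(ltnW leut).
- by move=> _ /imsetP[t Tt ->]; exists t; rewrite ?card_perm_initial.
apply: card_in_imset => t u _ _ /(congr1 (fun A : {set _} => #|A|)).
by rewrite !card_perm_initial => /val_inj.
Qed.

Lemma key_step T s x y : descents s \subset T -> y = x.+1 :> nat ->
  (key (perm_flag T s) (s x) < key (perm_flag T s) (s y))%N.
Proof.
move=> sT exy; have lexy : (x <= y)%N by rewrite exy.
have [Ty|nTy] := boolP (y \in T).
  apply: key_lt_level; apply: (level_lt_sub (A := s @: initial y)).
  - exact: perm_flag_initial.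
  - exact: imset_f.
  - by rewrite mem_perm_initial exy.
  by rewrite mem_perm_initial ltnn.
apply: key_lt_letter; first by apply: level_le_sub; apply: perm_flag_initial.
have : y \notin descents s by apply: contra nTy; apply: (subsetP sT).
rewrite inE => /existsPn/(_ x); rewrite exy eqxx /= -leqNgt leq_eqVlt.
case/orP=> // /eqP/val_inj/perm_inj exy'; move: exy; rewrite exy'; lia.
Qed.

Lemma key_mono T s x y : descents s \subset T -> (x < y)%N ->
  (key (perm_flag T s) (s x) < key (perm_flag T s) (s y))%N.
Proof.
move=> sT; case: y => y; elim: y => // y IHy lty; rewrite ltnS /= leq_eqVlt.
have lty' := ltnW lty; case/orP=> [/eqP exy|ltxy].
  by apply: key_step; rewrite //= exy.
apply: ltn_trans (IHy lty' ltxy) _; exact: key_step.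
Qed.

Definition rel_key C : rel 'I_d.+1 := fun x y => (key C x <= key C y)%N.

Lemma rel_key_trans C : transitive (rel_key C).
Proof. by move=> y x z; apply: leq_trans. Qed.

Lemma rel_key_anti C : antisymmetric (rel_key C).
Proof. by move=> x y; rewrite /rel_key -eqn_leq => /eqP/key_inj. Qed.

Lemma rel_key_total C : total (rel_key C).
Proof. by move=> x y; apply: leq_total. Qed.

Definition word s := [seq s x | x <- enum 'I_d.+1].

Lemma word_sorted C s :
  (forall x y, (x < y)%N -> (key C (s x) < key C (s y))%N) -> sorted (rel_key C) (word s).
Proof.
move=> H; rewrite sorted_map.
have : sorted ltn (map val (enum 'I_d.+1)) by rewrite val_enum_ord iota_ltn_sorted.
rewrite sorted_map; apply: sub_sorted => x y /= /H; apply: ltnW.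
Qed.

Lemma word_perm s : perm_eq (word s) (enum 'I_d.+1).
Proof.
apply: uniq_perm; rewrite ?enum_uniq //.
  by rewrite map_inj_uniq ?enum_uniq //; apply: perm_inj.
move=> x; rewrite mem_enum; apply/mapP; exists (s^-1%g x); rewrite ?permKV //.
by rewrite mem_enum.
Qed.

Lemma word_inj : injective word.
Proof.
move=> s s' e; apply/permP => x.
have : map s (enum 'I_d.+1) = map s' (enum 'I_d.+1) by [].
by move/eq_in_map; apply; rewrite mem_enum.
Qed.

(** Both words are the sorted list of the letters for the same key. *)
Lemma perm_flag_inj T : {in [set s | descents s \subset T] &, injective (perm_flag T)}.
Proof.
move=> s s'; rewrite !inE => sT s'T e; apply: word_inj.
apply: (@sorted_eq _ (rel_key (perm_flag T s))); [exact: rel_key_trans | exact: rel_key_anti | | | ].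
- by apply: word_sorted => x y; apply: key_mono.
- by rewrite e; apply: word_sorted => x y; apply: key_mono.
by apply: perm_trans (word_perm s) _; rewrite perm_sym word_perm.
Qed.

Lemma sorted_perm C : exists s : 'S_d.+1,
  forall x y, (x < y)%N -> (key C (s x) < key C (s y))%N.
Proof.
pose w := sort (rel_key C) (enum 'I_d.+1).
have szw : size w = d.+1 by rewrite size_sort size_enum_ord.
have uw : uniq w by rewrite sort_uniq enum_uniq.
pose f x := nth ord0 w x.
have fI : injective f.
  by move=> x y /eqP; rewrite /f nth_uniq ?szw // => /eqP/val_inj.
exists (perm fI) => x y ltxy; rewrite !permE ltn_neqAle; apply/andP; split.
  by apply: contraTneq ltxy => /key_inj/fI ->; rewrite ltnn.
have sw : sorted (rel_key C) w by apply: sort_sorted; apply: rel_key_total.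
have rel_refl : reflexive (rel_key C) by move=> z; apply: leqnn.
have H := sorted_leq_nth (@rel_key_trans C) rel_refl ord0 sw.
by apply: (H x y _ _ (ltnW ltxy)); rewrite inE szw ltn_ord.
Qed.

Lemma down_closed (A : {set 'I_d.+1}) :
  (forall x y, (x < y)%N -> y \in A -> x \in A) -> A = initial #|A|.
Proof.
move=> dA; apply/eqP; rewrite eqEcard card_initial ?leqnn ?andbT; last first.
  by rewrite -[X in (_ <= X)%N]card_ord max_card.
apply/subsetP=> x Ax; rewrite inE; apply: (@leq_trans #|initial x.+1|).
  by rewrite card_initial.
apply: subset_leq_card; apply/subsetP=> y; rewrite inE ltnS leq_eqVlt.
by case/orP=> [/eqP/val_inj->//|ltyx]; apply: dA ltyx Ax.
Qed.

(** Sort the letters by their key. Each member of the flag is closed downwards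
for the key, hence an initial segment of the word; and at a descent the level must
increase, so that a member of the flag ends there. *)
Lemma perm_flag_surj T C : C \in flags _ T ->
  exists2 s, descents s \subset T & perm_flag T s = C.
Proof.
move=> flC; have /flagsP[chC rC eC] := flC; have [s sK] := sorted_perm C.
have sKV x y : (key C (s x) < key C (s y))%N -> (x < y)%N.
  by rewrite ltnNge; apply: contraR; rewrite -leqNgt leq_eqVlt => /orP[/eqP/val_inj->//|/sK/ltnW].
have CE (A : {set 'I_d.+1}) : A \in C -> exists2 t, t \in T & A = s @: initial t.
  move=> CA; have [t Tt At] := rC A CA; exists t => //.
  have AE : A = s @: (s @^-1: A).
    apply/setP=> x; apply/idP/imsetP => [Ax|[y]]; last by rewrite inE => ? ->.
    by exists (s^-1%g x); rewrite ?inE permKV.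
  have -> : t = #|s @^-1: A| :> nat.
    by rewrite -At {1}AE card_imset //; apply: perm_inj.
  rewrite -down_closed // => x y ltxy; rewrite !inE => Ay; apply: contraTT ltxy => nAx.
  rewrite -leqNgt ltnW //; apply: sKV; apply: key_lt_level.
  apply: (level_lt_sub (A := A)) => // B CB Bx.
  have [sAB|sBA] := chC A B CA CB; first exact: (subsetP sAB).
  by rewrite (subsetP sBA _ Bx) in nAx.
have fE : perm_flag T s = C.
  apply/esym/eqP; rewrite eqEcard; apply/andP; split.
    by apply/subsetP=> A /CE[t Tt ->]; apply: imset_f.
  by have /flagsP[_ _ ->] := perm_flag_flags T s; rewrite eC.
exists s => //; apply/subsetP=> y; rewrite inE => /existsP[x /andP[/eqP exy lts]].
apply: contraT => nTy.
have ltxy : (x < y)%N by rewrite -exy.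
suff : (key C (s y) < key C (s x))%N by rewrite ltnNge ltnW // sK.
apply: key_lt_letter lts; apply: level_le_sub => A CA sxA.
have [t Tt At] := CE A CA; move: sxA; rewrite At !mem_perm_initial => ltxt.
rewrite ltn_neqAle -exy ltxt andbT; apply/eqP => et.
by move: nTy; rewrite (_ : y = t) ?Tt //; apply: val_inj; rewrite /= -et.
Qed.

(** The last letter is the largest letter of the last block, which is the
complement of the union of the flag. *)
Lemma cover_last T s i : descents s \subset T ->
  (forall x, x \notin cover (perm_flag T s) -> (x < i)%N) <-> (s ord_max < i)%N.
Proof.
move=> sT; set C := perm_flag T s.
have ncov x : (x \notin cover C) = [forall t in T, (t <= (s^-1%g x : 'I_d.+1))%N].
  apply/idP/forall_inP => [ncx t Tt|H]; last first.
    apply/bigcupP => -[_ /imsetP[t Tt ->]].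
    by rewrite -{1}(permKV s x) mem_perm_initial ltnNge H.
  rewrite leqNgt; apply: contra ncx => ltt; apply/bigcupP.
  by exists (s @: initial t); rewrite ?imset_f // -(permKV s x) mem_perm_initial.
split=> [H|lti x]; first by apply: H; rewrite ncov permK; apply/forall_inP=> t _; rewrite -ltnS.
move=> ncx; apply: leq_ltn_trans lti.
have lvl y : y \notin cover C -> level C y = #|C|.
  move=> ncy; apply: eq_card => A; rewrite inE; case: (boolP (A \in C)) => //= CA.
  by apply: contra ncy => Ay; apply/bigcupP; exists A.
have ncm : s ord_max \notin cover C.
  by rewrite ncov permK; apply/forall_inP=> t _; rewrite -ltnS.
have : (key C x <= key C (s ord_max))%N.
  rewrite -(permKV s x); have := leq_ord (s^-1%g x); rewrite leq_eqVlt.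
  case/orP=> [/eqP e|ltm]; last by apply: ltnW; apply: key_mono.
  by rewrite (_ : s^-1%g x = ord_max) //; apply: val_inj.
by rewrite /key !lvl // leq_add2l.
Qed.

Lemma card_cofinal m i : (m <= d.+1)%N -> (i <= d.+1)%N ->
  #|[set A : {set 'I_d.+1} | (~: A \subset initial i) && (#|A| == m)]| = 'C(i, d.+1 - m).
Proof.
move=> lem lei; rewrite -{2}(card_initial lei) -cards_draws.
rewrite -(card_imset _ (@setC_inj _)); apply: eq_card => A.
have cA := cardsC A; rewrite card_ord in cA.
apply/imsetP/idP => [[B]|]; rewrite !inE => /andP[sB /eqP cB].
  move=> ->; rewrite sB /=; have := cardsC B; rewrite card_ord cB.
  by move=> e; apply/eqP; rewrite -(addKn m #|~: B|) e.
exists (~: A); rewrite ?setCK // !inE setCK sB /=; apply/eqP.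
by apply: (@addnI #|A|); rewrite cA cB subnK.
Qed.

Lemma top_rank_le T : (top_rank T <= d)%N.
Proof. by apply/bigmax_leqP => i _; rewrite -ltnS. Qed.

Lemma card_descents_sub T i N : (i <= d.+1)%N ->
  (forall A : {set 'I_d.+1}, #|A| = top_rank T -> #|flags_over T A| = N) ->
  #|[set s : 'S_d.+1 | (descents s \subset T) && (s ord_max < i)%N]| =
  ('C(i, d.+1 - top_rank T) * N)%N.
Proof.
move=> lei cN; pose P : {pred {set 'I_d.+1}} := [pred A | ~: A \subset initial i].
rewrite -(@card_cofinal (top_rank T)) //; last by apply: leqW; apply: top_rank_le.
rewrite -(card_flags (P := P)) => [|A _]; last exact: cN.
rewrite -(card_in_imset (f := perm_flag T)); last first.
  move=> s s'; rewrite !inE => /andP[sT _] /andP[s'T _].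
  by apply: perm_flag_inj; rewrite inE.
apply: eq_card => C; rewrite [RHS]in_set; apply/imsetP/andP => [[s + ->]|[flC PC]].
  rewrite inE => /andP[sT ltsi]; split; first exact: perm_flag_flags.
  rewrite inE; apply/subsetP=> x; rewrite !inE; move: x.
  by apply/(cover_last _ sT).
have [s sT sE] := perm_flag_surj flC; exists s => //; rewrite inE sT /=.
apply/(cover_last _ sT) => x; rewrite sE => ncx.
by move: PC; rewrite inE => /subsetP/(_ x); rewrite !inE; apply.
Qed.

End PermFlags.

(** * Flag h-vectors as counts of permutations *)

(** When [R] is a proper subset of [S], adding or removing an element of
[S :\: R] pairs off terms of opposite signs. *)
Lemma moebius_subsets (I : finType) (R S : {set I}) :
  \sum_(U : {set I} | U \subset S) (-1) ^+ #|S :\: U| * (R \subset U)%:Z = (R == S)%:Z.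
Proof.
have [sRS|nsRS] := boolP (R \subset S); last first.
  rewrite big1 => [|U sUS]; first by case: eqP nsRS => // ->; rewrite subxx.
  by case: (boolP (R \subset U)) nsRS => [/subset_trans->//|_ _]; rewrite mulr0.
have [->|neRS] := eqVneq R S.
  rewrite (bigD1 S) //= setDv cards0 subxx mulr1 big1 ?addr0 // => U /andP[sUS neU].
  case: (boolP (S \subset U)) => [sSU|_]; last by rewrite mulr0.
  by rewrite eqEsubset sUS sSU in neU.
have /subsetPn[x Sx nRx] : ~~ (S \subset R).
  by apply: contra neRS => sSR; rewrite eqEsubset sRS.
rewrite (bigID (fun U : {set I} => x \in U)) /=.
rewrite (reindex_onto (fun U : {set I} => x |: U) (fun U => U :\ x)) /=; last first.
  by move=> U /andP[_ xU]; rewrite setD1K.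
rewrite (eq_bigl (fun U : {set I} => (U \subset S) && (x \notin U))); last first.
  move=> U; rewrite subUset sub1set Sx setU11 andbT /=; congr (_ && _).
  apply/eqP/idP => [<-|nxU]; last by rewrite setU1K.
  by rewrite setD11.
rewrite -big_split /= big1 // => U /andP[sUS nxU].
have -> : (R \subset x |: U) = (R \subset U).
  apply/idP/idP => [/subsetP sR|/subset_trans]; last by apply; apply: subsetUr.
  apply/subsetP => y Ry; move: (sR y Ry); rewrite !inE => /orP[/eqP exy|//].
  by rewrite -exy Ry in nRx.
have -> : #|S :\: U| = #|S :\: (x |: U)|.+1.
  by rewrite [LHS](cardsD1 x) inE nxU Sx setDDl setUC.
by rewrite exprS; ring.
Qed.

Section Main.
Variables (k : fieldType) (V : finType) (d : nat) (K : {set {set V}}).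
Hypotheses (cxK : simplicial_complex K) (dimK : complex_dim K = d%:Z).
Hypothesis cmK : cohen_macaulay k K.
Implicit Types (S T U : {set 'I_d.+1}) (s t : 'S_d.+1).

Let dimK' : complex_dim K = d.+1%:Z - 1. Proof. by rewrite dimK -addn1 PoszD addrK. Qed.

(** With [m = top_rank T], both sides are the number of flags below a face of size
[m] times [f_m = sum_i h_rev i * 'C(i, d.+1 - m)]: the binomial coefficient counts
the complements of the possible unions of the flag of a permutation. *)
Lemma flag_f_perms T : (flag_f K T)%:Z = \sum_(i < d.+2) h_rev K d.+1 i *
  (#|[set s : 'S_d.+1 | (descents s \subset T) && (s ord_max < i)%N]|)%:Z.
Proof.
case: cxK => K0 Ksub.
have Kpure F : F \in K -> exists G, [/\ G \in K, F \subset G & #|G| = d.+1].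
  by case/(cm_pure cxK dimK' cmK)/existsP=> G /and3P[KG sFG /eqP Gn]; exists G.
have [v0 _] : exists v : V, true.
  have [G [_ _ Gn]] := Kpure _ K0; have /card_gt0P[v _] : (0 < #|G|)%N by rewrite Gn.
  by exists v.
have lem := leqW (top_rank_le T).
pose N := #|flags_over T (initial d (top_rank T))|.
have -> : flag_f K T = (face_count K (top_rank T) * N)%N.
  rewrite /flag_f (maximal_flags K0 Ksub Kpure) -(card_flags (P := mem K)) => [|F _ Fm].
    apply: eq_card => C; rewrite [LHS]in_set [RHS]in_set.
    by apply: andb_id2l => flC; rewrite (flag_cover_sub K0 Ksub flC).
  by apply: (card_flags_over _ v0 ord0); rewrite card_initial.
rewrite PoszM (face_count_h K lem) mulr_suml; apply: eq_bigr => i _.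
rewrite (@card_descents_sub d T i N) ?PoszM ?mulrA // => [|A Am].
  by rewrite -ltnS.
by apply: (card_flags_over _ ord0 ord0); rewrite card_initial.
Qed.

Lemma flag_h_perms S : flag_h K S = \sum_(i < d.+2) h_rev K d.+1 i *
  (#|[set s in with_descents S | (s ord_max < i)%N]|)%:Z.
Proof.
rewrite /flag_h; under eq_bigr do rewrite flag_f_perms mulr_sumr.
rewrite exchange_big /=; apply: eq_bigr => i _.
under eq_bigr do rewrite mulrCA; rewrite -mulr_sumr; congr (_ * _).
have cE (P : pred 'S_d.+1) : (#|[set s | P s && (s ord_max < i)%N]|)%:Z =
    \sum_(s : 'S_d.+1 | (s ord_max < i)%N) (P s)%:Z.
  rewrite -sum1_card (big_morph _ PoszD (erefl 0%:Z)) big_mkcond [RHS]big_mkcond /=.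
  by apply: eq_bigr => s _; rewrite inE; case: (P s); case: ifP.
under eq_bigr do rewrite (cE (fun s => descents s \subset _)) mulr_sumr.
rewrite exchange_big /= (eq_bigr (fun s => (s \in with_descents S)%:Z)) => [|s _].
  by rewrite -cE; congr (Posz _); apply: eq_card => s; rewrite !inE.
by rewrite moebius_subsets inE.
Qed.

End Main.

(** A switch in the last place replaces the last letter by a smaller one; the
other switches leave it alone. *)
Lemma weak_le_last d (s t : 'S_d.+1) : weak_le s t -> (t ord_max <= s ord_max)%N.
Proof.
case/connectP=> p; elim: p s => [|u p IHp] s /=; first by move=> _ ->.
case/andP=> /existsP[j /existsP[i /and3P[/eqP eji ndi /eqP eu]]] pp et.
apply: leq_trans (IHp u pp et) _; rewrite eu permM.
have nej : ord_max != j :> 'I_d.+1.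
  by apply/eqP=> ej; have := ltn_ord i; rewrite -eji -ej /= ltnn.
have [ei|nei] := eqVneq i ord_max; last by rewrite tpermD // eq_sym.
rewrite -ei tpermR; move: ndi; rewrite inE => /existsPn/(_ j).
by rewrite eji eqxx /= -leqNgt.
Qed.

Theorem theorem8p4 (k : fieldType) (V : finType) (d : nat)
    (K : {set {set V}}) (S T : {set 'I_d.+1}) :
  simplicial_complex K ->
  complex_dim K = d%:Z ->
  cohen_macaulay k K ->
  S \subset bracket d ->
  T \subset bracket d ->
  dominates S T ->
  flag_h K T <= flag_h K S.
Proof.
move=> cxK dimK cmK _ _ [phi [phiI phiP]].
rewrite !(flag_h_perms cxK dimK cmK); apply: ler_sum => i _.
apply: ler_wpM2l.
  apply: (h_rev_ge0 _ cxK _ cmK); by rewrite dimK -addn1 PoszD addrK.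
rewrite lez_nat -(card_in_imset (f := phi)); last first.
  by move=> s t; rewrite !inE => /andP[sT _] /andP[tT _]; apply: phiI; rewrite inE.
apply: subset_leq_card; apply/subsetP=> _ /imsetP[t + ->].
rewrite inE => /andP[tT lti]; have [phiS le_phi] := phiP t tT.
by rewrite inE phiS /=; apply: leq_ltn_trans (weak_le_last le_phi) lti.
Qed.
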